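(* Let $\Gamma$ be a discrete amenable group and let $(\Gamma_\iota)$ be a Følner averaging net for $\Gamma$. Let $y$ be a selfadjoint element of $\mathrm S^\infty_n\otimes\mathrm L^\infty$. The net $(\mu_\iota)$ of $\mathrm S^\infty_n$-valued normalised counting measures of eigenvalues of the truncates of $y$ with respect to $\Gamma_\iota$ converges in the weak$^*$ topology to the spectral measure of $y$: $$\int_{\mathbb R}f(\alpha)\,d\mu_\iota(\alpha)\to\mathrm{Id}_{\mathrm S^\infty_n}\otimes\tau(f(y))$$ for every continuous function $f$ on $\mathbb R$ that tends to zero at infinity.
   Context: $\mathrm S^\infty_n$ is the algebra of $n\times n$ complex matrices. $\mathrm L^\infty\subseteq\mathbb B(\ell^2_\Gamma)$ is the von Neumann algebra generated by the left translations $\lambda_\gamma$, $\lambda_\gamma\mathrm e_\beta=\mathrm e_{\gamma\beta}$, with trace $\tau(x)=x_{\epsilon,\epsilon}$, where $\epsilon$ is the identity of $\Gamma$. A Følner averaging net of sets for $\Gamma$ is a net $(\Gamma_\iota)$ of finite (nonempty) subsets of $\Gamma$ such that $\#(\gamma\Gamma_\iota\Delta\Gamma_\iota)=o(\#\Gamma_\iota)$ for each $\gamma\in\Gamma$. Let $p_\iota$ be the orthogonal projection of $\ell^2_\Gamma$ onto $\ell^2_{\Gamma_\iota}$ and $\tilde p_\iota=\mathrm{Id}_{\ell^2_n}\otimes p_\iota$. The truncate of $y$ is $y_\iota=\tilde p_\iota y\tilde p_\iota^*\in\mathrm S^\infty_n\otimes\mathbb B(\ell^2_{\Gamma_\iota})$.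 The $\mathrm S^\infty_n$-valued normalised counting measure of eigenvalues $\mu_\iota$ of $y_\iota$ is defined by $$\int_{\mathbb R}f(\alpha)\,d\mu_\iota(\alpha)=\mathrm{Id}_{\mathrm S^\infty_n}\otimes\frac{\operatorname{tr}}{\#\Gamma_\iota}(f(y_\iota))$$ for every continuous function $f$ on $\mathbb R$ that tends to zero at infinity, where $\operatorname{tr}$ is the usual trace on $\mathbb B(\ell^2_{\Gamma_\iota})$. The $\mathrm S^\infty_n$-valued spectral measure $\mu$ of $y$ is defined by $\int_{\mathbb R}f(\alpha)\,d\mu(\alpha)=\mathrm{Id}_{\mathrm S^\infty_n}\otimes\tau(f(y))$ for all such $f$. *)

(* Defs.v *)
From HB Require Import structures.
From mathcomp Require Import all_boot all_order all_algebra finmap.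
From mathcomp Require Import complex.
From mathcomp Require Import all_classical all_reals all_analysis.
From mathcomp Require Import ring.
From mathcomp Require summability.

Set Implicit Arguments.
Unset Strict Implicit.
Unset Printing Implicit Defensive.

Import Order.TTheory GRing.Theory Num.Theory.
Import numFieldNormedType.Exports.

Local Open Scope classical_set_scope.
Local Open Scope complex_scope.
Local Open Scope ring_scope.

(* The usual topology of the complex numbers, given by the modulus. *)
HB.instance Definition _ (R : rcfType) := NormedModule.copy R[i] R[i]^o.

Section Ell2.
Variables (R : realType) (X : choiceType).
Implicit Types u v : X -> R[i].

Definition sqnorm u : \bar R :=
  \esum_(x in [set: X]) (Normc.normc (u x) ^+ 2)%:E.

Definition ell2_pred : {pred X -> R[i]} := [pred u | (sqnorm u < +oo)%E].

Lemma ell2_submod_closed : submod_closed ell2_pred.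
Proof.
have n0 (z : R[i]) : (0 <= (Normc.normc z ^+ 2)%:E)%E.
  by rewrite lee_fin sqr_ge0.
split=> [|a u v]; rewrite !inE /sqnorm.
  by rewrite esum1// => x _; rewrite Normc.normc0 expr0n.
move=> u2 v2.
pose c := Normc.normc a ^+ 2 + Normc.normc a ^+ 2.
have c0 : 0 <= c by rewrite addr_ge0 ?sqr_ge0.
pose m := Num.max c 2%:R.
have m0 : 0 <= m by rewrite le_max c0.
have le1 x : ((Normc.normc ((a *: u + v) x) ^+ 2)%:E <=
    m%:E * ((Normc.normc (u x) ^+ 2)%:E + (Normc.normc (v x) ^+ 2)%:E))%E.
  rewrite -EFinD -EFinM lee_fin.
  have -> : (a *: u + v) x = a * u x + v x by [].
  have h := le_normcD (a * u x) (v x).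
  have hp (z : R[i]) : 0 <= Normc.normc z by case: z => p q; exact: sqrtr_ge0.
  have h2 : Normc.normc (a * u x + v x) ^+ 2 <=
            (Normc.normc (a * u x) + Normc.normc (v x)) ^+ 2.
    by rewrite ler_sqr ?nnegrE ?addr_ge0.
  apply: (le_trans h2); rewrite Normc.normcM.
  set A := Normc.normc a; set U := Normc.normc (u x); set V := Normc.normc _.
  have h3 : (A * U + V) ^+ 2 <= (A ^+ 2 + A ^+ 2) * U ^+ 2 + 2%:R * V ^+ 2.
    rewrite -subr_ge0 (_ : _ - _ = (A * U - V) ^+ 2) ?sqr_ge0//.
    by rewrite !expr2 !mulrDl !mulrDr !mulrN !mulNr; ring.
  apply: (le_trans h3); rewrite mulrDr lerD// ler_wpM2r ?sqr_ge0//.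
    by rewrite le_max lexx.
  by rewrite le_max lexx orbT.
have := @le_esum R X [set: X] _ _ (fun x _ => le1 x).
move/le_lt_trans; apply.
have [M hM] : exists M : R,
    (\esum_(x in [set: X]) ((Normc.normc (u x) ^+ 2)%:E +
       (Normc.normc (v x) ^+ 2)%:E) <= M%:E)%E.
  exists (fine (sqnorm u + sqnorm v)); rewrite esumD//.
  rewrite fineK// ge0_fin_numE ?lte_add_pinfty//.
  by rewrite adde_ge0// /sqnorm esum_ge0.
apply: (@le_lt_trans _ _ (m%:E * M%:E)%E); last by rewrite -EFinM ltry.
apply: ge_ereal_sup => _ [F FX <-].
rewrite -ge0_mule_fsumr; last by move=> i; rewrite adde_ge0.
rewrite lee_wpmul2l ?lee_fin//; apply: le_trans hM.
by apply: esum_ge; exists F.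
Qed.

HB.instance Definition _ := GRing.isSubmodClosed.Build R[i] (X -> R[i])
  ell2_pred ell2_submod_closed.

Record ell2 := Ell2 { ell2_fun :> X -> R[i]; _ : ell2_fun \in ell2_pred }.
HB.instance Definition _ := [isSub for ell2_fun].
HB.instance Definition _ := [Choice of ell2 by <:].
HB.instance Definition _ := [SubChoice_isSubLmodule of ell2 by <:].

Definition ell2_norm (u : ell2) : R := Num.sqrt (fine (sqnorm u)).

(* Linear in the first variable; [summability.sum] is the limit of the sums
   over finite subsets of [X]. *)
Definition inner (u v : ell2) : R[i] :=
  summability.sum (fun x => u x * (v x)^*%C).

End Ell2.

Lemma ell2_relabel (R : realType) (X Y : choiceType) (g : Y -> option X) :
    (forall y y' x, g y = Some x -> g y' = Some x -> y = y') ->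
  forall u : ell2 R X, (fun y => oapp u 0 (g y)) \in @ell2_pred R Y.
Proof.
move=> ginj [u] /=; rewrite !inE; apply: le_lt_trans; rewrite /sqnorm.
pose D := [set y | g y].
have -> : \esum_(y in [set: Y]) (Normc.normc (oapp u 0 (g y)) ^+ 2)%:E =
          \esum_(y in D) (Normc.normc (oapp u 0 (g y)) ^+ 2)%:E.
  rewrite [RHS]esum_mkcond; apply: eq_esum => y _.
  case: ifPn => //; rewrite notin_setE /D /=.
  by case: (g y) => // _; rewrite [oapp _ _ _]/= Normc.normc0 expr0n.
have [[x0 _]|noX] := pselect (exists x : X, True); last first.
  rewrite esum1 => [|y]; last first.
    by rewrite /D /=; case: (g y) => // x; case: noX; exists x.
  by apply: esum_ge0 => x; case: noX; exists x.
have einj : set_inj D (fun y => odflt x0 (g y)).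
  move=> y y'; rewrite !inE /D /=.
  case Ey: (g y) => [x|]//; case Ey': (g y') => [x'|]//= _ _ xx'.
  by apply: (ginj _ _ x); rewrite // Ey' xx'.
rewrite (_ : esum D _ = \esum_(y in D)
    ((fun x => (Normc.normc (u x) ^+ 2)%:E) (odflt x0 (g y)))); last first.
  by apply: eq_esum => y; rewrite /D /=; case: (g y).
rewrite -(esum_image _ _ (fun x => (Normc.normc (u x) ^+ 2)%:E) einj).
rewrite [leLHS]esum_mkcond; apply: le_esum => x _.
by case: ifP => // _; rewrite lee_fin sqr_ge0.
Qed.

Section Operators.
Variable R : realType.
Implicit Types X Y : choiceType.

Definition bounded_op X Y (T : ell2 R X -> ell2 R Y) : Prop :=
  linear T /\ exists M : R, forall u, ell2_norm (T u) <= M * ell2_norm u.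

Definition selfadjoint X (T : ell2 R X -> ell2 R X) : Prop :=
  forall u v, inner (T u) v = inner u (T v).

Definition commutant X (A : set (ell2 R X -> ell2 R X)) :
    set (ell2 R X -> ell2 R X) :=
  [set T | bounded_op T /\ forall S, A S -> T \o S = S \o T].

Definition spectrum X (T : ell2 R X -> ell2 R X) : set R[i] :=
  [set l | ~ exists S, [/\ bounded_op S,
                           forall u, S (T u - l *: u) = u
                         & forall u, T (S u) - l *: S u = u]].

Definition op_horner X (p : {poly R[i]}) (T : ell2 R X -> ell2 R X) :
    ell2 R X -> ell2 R X :=
  fun u => \sum_(k < size p) p`_k *: iter k T u.

(* [Z] is the limit in operator norm of polynomials [p k] in [T], where [p k]
   tends to [f] uniformly on the spectrum of [T]. For a bounded selfadjoint [T],
   whose spectrum is real, and [f] continuous there is exactly one such [Z],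
   the operator [f(T)] of the continuous functional calculus. *)
Definition is_funcalc X (f : R -> R[i]) (T Z : ell2 R X -> ell2 R X) : Prop :=
  exists p : nat -> {poly R[i]},
    (forall e : R, 0 < e -> \forall k \near \oo, forall t : R,
       spectrum T t%:C -> Normc.normc ((p k).[t%:C] - f t) <= e) /\
    (forall e : R, 0 < e -> \forall k \near \oo, forall u,
       ell2_norm (op_horner (p k) T u - Z u) <= e * ell2_norm u).

Definition funcalc X (f : R -> R[i]) (T : ell2 R X -> ell2 R X) :
    ell2 R X -> ell2 R X :=
  xget (fun _ => 0) [set Z | is_funcalc f T Z].

Lemma delta_subproof X (x : X) :
  (fun x' => (x' == x)%:R) \in @ell2_pred R X.
Proof.
rewrite inE /sqnorm (esumID [set x])// => [|y _]; last by rewrite lee_fin sqr_ge0.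
rewrite setTI esum_set1 ?lee_fin ?sqr_ge0// esum1 ?adde0 ?ltry//.
by move=> y [_ /= /eqP /negPf ->]; rewrite Normc.normc0 expr0n.
Qed.

Definition delta X (x : X) : ell2 R X := Ell2 (delta_subproof x).

Lemma restr_subproof X (A : {fset X}) (u : ell2 R X) :
  (fun a : A => u (val a)) \in @ell2_pred R A.
Proof.
by apply: (@ell2_relabel R X A (fun a => Some (val a))) => a b x [<-] [/val_inj].
Qed.

Definition restr X (A : {fset X}) (u : ell2 R X) : ell2 R A :=
  Ell2 (restr_subproof A u).

Lemma ext_subproof X (A : {fset X}) (u : ell2 R A) :
  (fun x => oapp u 0 (insub x)) \in @ell2_pred R X.
Proof.
apply: ell2_relabel => x y a.
by case: insubP => // a1 _ <- [<-]; case: insubP => // b1 _ <- [<-].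
Qed.

(* Extension by zero, the adjoint of [restr A]. *)
Definition ext X (A : {fset X}) (u : ell2 R A) : ell2 R X :=
  Ell2 (ext_subproof u).

Section Tensor.
Variable n : nat.

(* [ell2 R ('I_n * X)] is the tensor product of the n-dimensional Hilbert space
   and [ell2 R X]; [slot i] is [u |-> e_i (x) u] and [slice i] its adjoint. *)

Lemma slice_subproof X (i : 'I_n) (u : ell2 R ('I_n * X)%type) :
  (fun x => u (i, x)) \in @ell2_pred R X.
Proof.
by apply: (@ell2_relabel R _ X (fun x => Some (i, x))) => x y p [<-] [<-].
Qed.

Definition slice X (i : 'I_n) (u : ell2 R ('I_n * X)%type) : ell2 R X :=
  Ell2 (slice_subproof i u).

Lemma slot_subproof X (i : 'I_n) (u : ell2 R X) :
  (fun p => oapp u 0 (if p.1 == i then Some p.2 else None))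
    \in @ell2_pred R ('I_n * X)%type.
Proof.
apply: ell2_relabel => -[i1 x1] [i2 x2] x /=.
by case: eqP => //= -> [<-]; case: eqP => //= -> [<-].
Qed.

Definition slot X (i : 'I_n) (u : ell2 R X) : ell2 R ('I_n * X)%type :=
  Ell2 (slot_subproof i u).

Definition tens X Y (a : 'M[R[i]]_n) (T : ell2 R X -> ell2 R Y) :
    ell2 R ('I_n * X)%type -> ell2 R ('I_n * Y)%type :=
  fun u => \sum_i \sum_j a i j *: slot i (T (slice j u)).

Definition mx_tensor X (A : set (ell2 R X -> ell2 R X)) :
    set (ell2 R ('I_n * X)%type -> ell2 R ('I_n * X)%type) :=
  [set y | exists (m : nat) (a : 'I_m -> 'M[R[i]]_n)
                  (x : 'I_m -> ell2 R X -> ell2 R X),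
     (forall k, A (x k)) /\ y = fun u => \sum_k tens (a k) (x k) u].

(* [Id (x) phi], for a linear functional [phi] on operators. *)
Definition id_tensor X (phi : (ell2 R X -> ell2 R X) -> R[i])
    (z : ell2 R ('I_n * X)%type -> ell2 R ('I_n * X)%type) : 'M[R[i]]_n :=
  \matrix_(i, j) phi (fun u => slice i (z (slot j u))).

Lemma slice_tens X (a : 'M[R[i]]_n) (x : ell2 R X -> ell2 R X) i j :
  linear x -> (fun u => slice i (tens a x (slot j u))) = fun u => a i j *: x u.
Proof.
move=> lx; have x0 : x 0 = 0.
  by have := lx (-1) 0 0; rewrite scaler0 addr0 scaleN1r addNr.
have funD (Z : choiceType) (u v : ell2 R Z) z : (u + v) z = u z + v z by [].
have fun0 (Z : choiceType) z : (0 : ell2 R Z) z = 0 by [].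
have funZ (Z : choiceType) c (u : ell2 R Z) z : (c *: u) z = c * u z by [].
have zf c (h : 'I_n * X -> R[i]) p : (c *: h) p = c * h p by [].
have fun_sum (Z : choiceType) (J : Type) (r : seq J) (F : J -> ell2 R Z) z :
    (\sum_(k <- r) F k) z = \sum_(k <- r) F k z.
  by elim/big_rec2: _ => // k s u _ <-; rewrite funD.
apply/funext => u; apply/val_inj/funext => b /=.
rewrite /tens fun_sum (bigD1 i)//= fun_sum (bigD1 j)//=.
rewrite [X in _ + X + _]big1 => [|k kj]; last first.
  suff -> : slice k (slot j u) = 0 by rewrite x0 zf /= eqxx mulr0.
  by apply/val_inj/funext => c /=; rewrite (negPf kj).
rewrite [X in _ + X]big1 => [|k ki]; last first.
  by rewrite fun_sum big1// => l _; rewrite funZ /= eq_sym (negPf ki) mulr0.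
rewrite !addr0 zf /= eqxx /=; suff -> : slice j (slot j u) = u by [].
by apply/val_inj/funext => c /=; rewrite eqxx.
Qed.

End Tensor.

End Operators.

Section Group.
Variables (R : realType) (Gamma : groupType).
Implicit Types (g b : Gamma) (A : {fset Gamma}).
Local Notation op X := (ell2 R X -> ell2 R X).

Lemma lambda_subproof g (u : ell2 R Gamma) :
  (fun b => u (g^-1 * b)%g) \in @ell2_pred R Gamma.
Proof.
apply: (@ell2_relabel R _ _ (fun b => Some (g^-1 * b)%g)) => b c d [<-] [].
by move/mulgI.
Qed.

Definition lambda g (u : ell2 R Gamma) : ell2 R Gamma :=
  Ell2 (lambda_subproof g u).

Lemma lambda_delta g b : lambda g (delta R b) = delta R (g * b)%g.
Proof.
apply/val_inj/funext => c /=; congr (_ %:R); congr nat_of_bool.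
by apply/eqP/eqP => [<-|->]; rewrite ?mulKg ?mulVKg.
Qed.

(* The von Neumann algebra generated by the left translations, as a bicommutant:
   the set of the translations is closed under adjoints. *)
Definition Linf : set (op Gamma) := commutant (commutant (range lambda)).

Definition tau (x : op Gamma) : R[i] := x (delta R 1%g) 1%g.

Definition normalised_trace A (z : op A) : R[i] :=
  (\sum_(a : A) z (delta R a) a) / #|` A|%:R.

(* A left-invariant mean, as a finitely additive probability measure. *)
Definition amenable : Prop :=
  exists m : set Gamma -> R,
    [/\ m setT = 1, forall B, 0 <= m B,
        forall B C, B `&` C = set0 -> m (B `|` C) = m B + m C
      & forall g B, m [set (g * b)%g | b in B] = m B].

Definition directed (I : Type) (le : I -> I -> Prop) : Prop :=
  [/\ inhabited I, forall i, le i i,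
      forall i j k, le i j -> le j k -> le i k
    & forall i j, exists2 k, le i k & le j k].

Definition net_filter (I : Type) (le : I -> I -> Prop) : set_system I :=
  filter_from setT (fun i => [set j | le i j]).

Definition translate g A : {fset Gamma} := [fset (g * b)%g | b in A]%fset.

Definition folner_net (I : Type) (le : I -> I -> Prop)
    (F : I -> {fset Gamma}) : Prop :=
  (forall i, F i != fset0) /\
  forall g, (fun i : I =>
      #|` ((translate g (F i) `\` F i) `|` (F i `\` translate g (F i)))%fset|%:R
        / #|` F i|%:R : R) @ net_filter le --> (0 : R).

Variable n : nat.

Definition truncate A (y : op ('I_n * Gamma)%type) : op ('I_n * A)%type :=
  fun u => tens 1%:M (@restr R Gamma A) (y (tens 1%:M (@ext R Gamma A) u)).

(* The integral of [f] against the matrix-valued normalised counting measure of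
   eigenvalues of the truncate of [y]; these integrals define the measure. *)
Definition int_counting_measure (y : op ('I_n * Gamma)%type) A
    (f : R -> R[i]) : 'M[R[i]]_n :=
  id_tensor (@normalised_trace A) (funcalc f (truncate (A := A) y)).

(* The integral of [f] against the matrix-valued spectral measure of [y]. *)
Definition int_spectral_measure (y : op ('I_n * Gamma)%type)
    (f : R -> R[i]) : 'M[R[i]]_n :=
  id_tensor tau (funcalc f y).

End Group.

(* Main.v *)
Require Import Defs.
From mathcomp Require Import all_boot all_order all_algebra finmap.
From mathcomp Require Import complex.
From mathcomp Require Import all_classical all_reals all_analysis.
From mathcomp Require Import ring lra.
From mathcomp Require summability.
Import Order.TTheory GRing.Theory Num.Theory.
Import numFieldNormedType.Exports.
Local Open Scope classical_set_scope.
Local Open Scope complex_scope.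
Local Open Scope ring_scope.

(** The von Neumann algebra enters through two properties of y: it is bounded, and
    it commutes with the right translations of the group, because these lie in the
    commutant of the left ones (mx_tensor_Linf). Hence the diagonal coefficients of a polynomial p(y)
    do not depend on the point of the group, and the spectral integral of p is
    their average over any finite set A.

    For a polynomial, the theorem therefore compares (y^k)(a, a) with the
    coefficient of the k-th power of the truncate, averaged over the points a of A.
    With P the projection onto A, that power is the compression to A of (y P)^k,
    and telescoping y^k - (y P)^k bounds the difference at a by multiples of the
    norms of (1 - P) y^m e_a for m < k (dist_iter_compression). Now y^m e_a is the
    translate by a of the fixed vector y^m e_1, which up to e lives on a finite set
    S; so (1 - P) y^m e_a is small unless g a is outside A for some g in S, and the
    Folner condition makes such points a rare (avg_cut_small).

    The passage from polynomials to a continuous f is the continuous functional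
    calculus. The bound |q(T)| <= sup of |q| on the spectrum of a bounded
    selfadjoint T (spectral_bound) comes from factoring c^2 - conj(q) q into linear
    factors, c being the norm of q(T): as c^2 - q(T)* q(T) is not bounded below, one
    of the factors is not invertible. Together with the completeness of the space
    and the Weierstrass theorem it shows that f(T) exists and that |q - f| <= e
    on [-M, M] forces |q(T) - f(T)| <= 3 e whenever |T| <= M (funcalc_approx). One
    polynomial q thus serves y and all its truncates at once, since these are
    selfadjoint with the same bound M. *)

Set Implicit Arguments.
Unset Strict Implicit.
Unset Printing Implicit Defensive.

Local Notation nc := Normc.normc.
Local Notation Re := complex.Re.
Local Notation Im := complex.Im.

(** * Moduli of complex numbers, and the norm of square-summable families *)

Section Modulus.
Variable R : rcfType.
Implicit Types z : R[i].

Lemma normc_ge0 z : 0 <= nc z.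
Proof. by case: z => a b; exact: sqrtr_ge0. Qed.

Lemma sqr_nc z : nc z ^+ 2 = Re z ^+ 2 + Im z ^+ 2.
Proof. by case: z => a b /=; rewrite sqr_sqrtr // addr_ge0 ?sqr_ge0. Qed.

Lemma normcR (a : R) : nc a%:C = `|a|.
Proof. by rewrite /= expr0n addr0 sqrtr_sqr. Qed.

Lemma normr_normc z : `|z| = (nc z)%:C.
Proof. by case: z. Qed.

Lemma ReB z w : Re (z - w) = Re z - Re w.
Proof. by case: z; case: w. Qed.
Lemma ImB z w : Im (z - w) = Im z - Im w.
Proof. by case: z; case: w. Qed.

Lemma normc_i : nc 'i%C = 1 :> R.
Proof. by rewrite /= expr0n expr1n add0r sqrtr1. Qed.

Lemma normr_Re_le z : `|Re z| <= nc z.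
Proof. by have := normc_ge_Re z; rewrite normr_normc lecR. Qed.

Lemma normr_Im_le z : `|Im z| <= nc z.
Proof.
have := normr_Re_le ('i%C * z); rewrite Normc.normcM normc_i mul1r.
by case: z => a b; rewrite /= mul0r mul1r sub0r normrN.
Qed.

Lemma normcB_sym z w : nc (z - w) = nc (w - z).
Proof. by rewrite -normcN opprB. Qed.

Lemma le_normc_sum (J : Type) (r : seq J) (P : pred J) (h : J -> R[i]) :
  nc (\sum_(k <- r | P k) h k) <= \sum_(k <- r | P k) nc (h k).
Proof.
elim/big_rec2: _ => [|k s u _ le_us]; first by rewrite Normc.normc0.
by apply: le_trans (le_normcD _ _) _; rewrite lerD2l.
Qed.

End Modulus.

Section Norm.
Variables (R : realType) (X : choiceType).
Implicit Types (u v w : ell2 R X) (A : {fset X}) (h : X -> R[i]).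

Lemma ell2P u v : u =1 v -> u = v.
Proof. by move=> uv; apply/val_inj/funext. Qed.

Lemma ell2D u v x : (u + v) x = u x + v x. Proof. by []. Qed.
Lemma ell2N u x : (- u) x = - u x. Proof. by []. Qed.
Lemma ell2Z c u x : (c *: u) x = c * u x. Proof. by []. Qed.
Lemma ell20 x : (0 : ell2 R X) x = 0. Proof. by []. Qed.
Lemma ell2_sum (J : Type) (r : seq J) (P : pred J) (h : J -> ell2 R X) x :
  (\sum_(k <- r | P k) h k) x = \sum_(k <- r | P k) h k x.
Proof. by elim/big_rec2: _ => // k s u _ <-; rewrite ell2D. Qed.

Lemma sqnorm_le h (c : R) :
  (forall A, \sum_(x <- A) nc (h x) ^+ 2 <= c) -> (sqnorm h <= c%:E)%E.
Proof.
move=> hc; apply: ge_ereal_sup => _ [F [finF _] <-].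
have [A FA] := finite_fsetP.1 finF.
have -> : F = [set` (A : seq X)] by rewrite FA.
rewrite -fsbig_seq ?fset_uniq // sumEFin lee_fin; exact: hc.
Qed.

Lemma finsum_sqnorm h A : ((\sum_(x <- A) nc (h x) ^+ 2)%:E <= sqnorm h)%E.
Proof.
apply: esum_ge; exists [set` (A : seq X)]; first by split => //; exact: finite_seq.
by rewrite -fsbig_seq ?fset_uniq // sumEFin.
Qed.

Lemma sqr_ell2_norm u : (ell2_norm u ^+ 2)%:E = sqnorm u.
Proof.
have u0 : (0 <= sqnorm u)%E by apply: esum_ge0 => x _; rewrite lee_fin sqr_ge0.
have ufin : sqnorm u \is a fin_num.
  by rewrite ge0_fin_numE //; case: u {u0} => h /=; rewrite inE.
by rewrite /ell2_norm sqr_sqrtr ?fineK // fine_ge0.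
Qed.

Lemma ell2_norm_ge0 u : 0 <= ell2_norm u.
Proof. exact: sqrtr_ge0. Qed.

Lemma finsum_norm u A : \sum_(x <- A) nc (u x) ^+ 2 <= ell2_norm u ^+ 2.
Proof. by rewrite -lee_fin sqr_ell2_norm finsum_sqnorm. Qed.

Lemma ell2_norm_le u (c : R) : 0 <= c ->
  (forall A, \sum_(x <- A) nc (u x) ^+ 2 <= c ^+ 2) -> ell2_norm u <= c.
Proof.
move=> c0 uc; rewrite -ler_sqr ?nnegrE ?ell2_norm_ge0 //.
by rewrite -lee_fin sqr_ell2_norm sqnorm_le.
Qed.

Lemma ell2_norm_approx u (e : R) : 0 < e ->
  exists A, ell2_norm u ^+ 2 - e < \sum_(x <- A) nc (u x) ^+ 2.
Proof.
move=> e0; apply: contrapT => /forallNP nA.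
suff : (sqnorm u <= (ell2_norm u ^+ 2 - e)%:E)%E.
  by rewrite -sqr_ell2_norm lee_fin lerBrDr gerDl leNgt e0.
by apply: sqnorm_le => A; rewrite leNgt; apply/negP/nA.
Qed.

Lemma finsum_mono h A B : (A `<=` B)%fset ->
  \sum_(x <- A) nc (h x) ^+ 2 <= \sum_(x <- B) nc (h x) ^+ 2.
Proof.
move=> AB; rewrite [leRHS](big_fsetID _ (mem A)) /=.
rewrite (_ : [fset x in B | x \in A]%fset = A); last first.
  by apply/fsetP => x; rewrite !inE /= andbC; case: (boolP (x \in A)) => //= /(fsubsetP AB).
by rewrite lerDl sumr_ge0 // => x _; rewrite sqr_ge0.
Qed.

Lemma ell2_norm_coord u x : nc (u x) <= ell2_norm u.
Proof.
rewrite -ler_sqr ?nnegrE ?normc_ge0 ?ell2_norm_ge0 //.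
by have := finsum_norm u [fset x]%fset; rewrite big_seq_fset1.
Qed.

Lemma ell2_norm0 : ell2_norm (0 : ell2 R X) = 0.
Proof.
apply/le_anti; rewrite ell2_norm_ge0 andbT; apply: ell2_norm_le => // A.
by rewrite big1 ?expr0n // => x _; rewrite ell20 Normc.normc0 expr0n.
Qed.

Lemma ell2_norm_eq0 u : ell2_norm u = 0 -> u = 0.
Proof.
move=> u0; apply: ell2P => x; apply: Normc.eq0_normc; apply/le_anti.
by rewrite normc_ge0 -u0 ell2_norm_coord.
Qed.

Lemma ell2_normD u v : ell2_norm (u + v) <= ell2_norm u + ell2_norm v.
Proof.
apply/ler_addgt0Pr => e e0.
set p := ell2_norm u + e / 2; set q := ell2_norm v + e / 2.
have e2 : 0 < e / 2 by rewrite divr_gt0.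
have p0 : 0 < p by rewrite ltr_wpDl ?ell2_norm_ge0.
have q0 : 0 < q by rewrite ltr_wpDl ?ell2_norm_ge0.
have -> : ell2_norm u + ell2_norm v + e = p + q by rewrite /p /q; field.
apply: ell2_norm_le => [|A]; first by rewrite addr_ge0 ?ltW.
(* Jensen's inequality for the square, with weights proportional to p and q. *)
have jensen x : nc ((u + v) x) ^+ 2 <=
    (p + q) * (p^-1 * nc (u x) ^+ 2 + q^-1 * nc (v x) ^+ 2).
  rewrite ell2D; set a := nc (u x); set b := nc (v x).
  have ab : nc (u x + v x) ^+ 2 <= (a + b) ^+ 2.
    by rewrite ler_sqr ?nnegrE ?addr_ge0 ?normc_ge0 // le_normcD.
  apply: le_trans ab _; rewrite -subr_ge0.
  have -> : (p + q) * (p^-1 * a ^+ 2 + q^-1 * b ^+ 2) - (a + b) ^+ 2 =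
      (q * a - p * b) ^+ 2 / (p * q).
    by field; rewrite !gt_eqF.
  by rewrite divr_ge0 ?sqr_ge0 // mulr_ge0 // ltW.
apply: le_trans (ler_sum _ (fun x _ => jensen x)) _.
rewrite -mulr_sumr expr2; apply: ler_wpM2l; first by rewrite addr_ge0 ?ltW.
rewrite big_split /= -!mulr_sumr.
have half w r : 0 < r -> ell2_norm w <= r ->
    r^-1 * \sum_(x <- A) nc (w x) ^+ 2 <= r.
  move=> r0 wr; rewrite ler_pdivrMl // -expr2 (le_trans (finsum_norm w A)) //.
  by rewrite ler_sqr ?nnegrE ?ell2_norm_ge0 // ltW.
by apply: lerD; apply: half => //; rewrite lerDl ltW.
Qed.

Lemma ell2_normZ_le (c : R[i]) u : ell2_norm (c *: u) <= nc c * ell2_norm u.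
Proof.
apply: ell2_norm_le => [|A]; first by rewrite mulr_ge0 ?normc_ge0 ?ell2_norm_ge0.
under eq_bigr do rewrite ell2Z Normc.normcM exprMn.
by rewrite -mulr_sumr exprMn ler_wpM2l ?sqr_ge0 // finsum_norm.
Qed.

Lemma ell2_normZ (c : R[i]) u : ell2_norm (c *: u) = nc c * ell2_norm u.
Proof.
apply/le_anti; rewrite ell2_normZ_le /=.
have [->|c0] := eqVneq c 0; first by rewrite Normc.normc0 mul0r ell2_norm_ge0.
have nc0 : 0 < nc c.
  by rewrite lt_neqAle normc_ge0 andbT eq_sym; apply: contra_neq c0 => /Normc.eq0_normc.
rewrite -ler_pdivlMl // -Normc.normcV.
by rewrite -{1}[u](scalerK c0) ell2_normZ_le.
Qed.

Lemma ell2_normN u : ell2_norm (- u) = ell2_norm u.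
Proof.
by rewrite -scaleN1r ell2_normZ normcN Normc.normc1 mul1r.
Qed.

Lemma ell2_normB_sym u v : ell2_norm (u - v) = ell2_norm (v - u).
Proof. by rewrite -ell2_normN opprB. Qed.

Lemma ell2_normB u v : ell2_norm (u - v) <= ell2_norm u + ell2_norm v.
Proof. by rewrite -(ell2_normN v) ell2_normD. Qed.

Lemma ell2_dist_triangle w u v :
  ell2_norm (u - v) <= ell2_norm (u - w) + ell2_norm (w - v).
Proof. by rewrite -{1}(subrKA w) ell2_normD. Qed.

Lemma ell2_norm_sum (J : Type) (r : seq J) (P : pred J) (h : J -> ell2 R X) :
  ell2_norm (\sum_(k <- r | P k) h k) <= \sum_(k <- r | P k) ell2_norm (h k).
Proof.
elim/big_rec2: _ => [|k s u _ le_us]; first by rewrite ell2_norm0.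
by apply: le_trans (ell2_normD _ _) _; rewrite lerD2l.
Qed.

Lemma real_cauchy_cvg (a : nat -> R) :
    (forall e, 0 < e -> exists N, forall m k, (N <= m)%N -> (N <= k)%N ->
       `|a m - a k| <= e) ->
  cvgn a.
Proof.
move=> ca; apply/cauchy_cvgP/cauchy_exP => e e0.
have [N aN] := ca (e / 2) ltac:(by rewrite divr_gt0).
exists (a N); exists N => // k /= Nk.
rewrite /ball_ /=; apply: le_lt_trans (aN _ _ (leqnn N) Nk) _.
by rewrite gtr_pMr // invf_lt1 ?ltr1n.
Qed.

(** A Cauchy sequence converges coordinatewise, and the Cauchy estimate for each
    finite partial sum survives the limit. *)
Lemma ell2_complete (u : nat -> ell2 R X) :
    (forall e, 0 < e -> exists N, forall m k, (N <= m)%N -> (N <= k)%N ->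
       ell2_norm (u m - u k) <= e) ->
  exists v, forall e, 0 < e -> exists N, forall m, (N <= m)%N ->
    ell2_norm (u m - v) <= e.
Proof.
move=> cu.
have cRe x : cvgn (fun k => Re (u k x)).
  apply: real_cauchy_cvg => e /cu[N uN]; exists N => m k Nm Nk.
  by rewrite -ReB (le_trans (normr_Re_le _)) // (le_trans _ (uN _ _ Nm Nk)) // (ell2_norm_coord (u m - u k)).
have cIm x : cvgn (fun k => Im (u k x)).
  apply: real_cauchy_cvg => e /cu[N uN]; exists N => m k Nm Nk.
  by rewrite -ImB (le_trans (normr_Im_le _)) // (le_trans _ (uN _ _ Nm Nk)) // (ell2_norm_coord (u m - u k)).
pose h x : R[i] :=
  limn (fun k => Re (u k x)) +i* limn (fun k => Im (u k x)).
have hfin e N (A : {fset X}) m : (forall m k, (N <= m)%N -> (N <= k)%N ->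
       ell2_norm (u m - u k) <= e) -> (N <= m)%N ->
    \sum_(x <- A) nc (u m x - h x) ^+ 2 <= e ^+ 2.
  move=> uN Nm.
  have lim : (fun k => \sum_(x <- A) nc (u m x - u k x) ^+ 2) @ \oo -->
      \sum_(x <- A) nc (u m x - h x) ^+ 2.
    apply: cvg_big => [|x _]; first exact: add_continuous.
    under eq_fun do rewrite sqr_nc ReB ImB.
    rewrite sqr_nc ReB ImB; apply: cvgD.
      by rewrite expr2; apply: cvgM; apply: cvgB => //; apply: cvg_cst.
    by rewrite expr2; apply: cvgM; apply: cvgB => //; apply: cvg_cst.
  rewrite -(cvg_lim _ lim) //; apply: limr_le; first by apply/cvg_ex; eexists; exact: lim.
  near=> k; apply: le_trans (finsum_norm (u m - u k) A) _.
  rewrite ler_sqr ?nnegrE ?ell2_norm_ge0 //; last first.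
    exact: le_trans (ell2_norm_ge0 _) (uN m m Nm Nm).
  by apply: uN => //; near: k; exists N.
have [N uN] := cu 1 ltr01.
have hB : (u N : X -> R[i]) - h \in @ell2_pred R X.
  rewrite inE; apply: (@le_lt_trans _ _ (1 ^+ 2)%:E); last by rewrite ltry.
  by apply: sqnorm_le => A; apply: (hfin 1 N A N uN).
exists (u N - Ell2 hB) => e /cu[K uK]; exists K => m Km.
apply: ell2_norm_le => [|A].
  exact: le_trans (ell2_norm_ge0 _) (uK m m Km Km).
rewrite (eq_bigr (fun x => nc (u m x - h x) ^+ 2)); first exact: hfin uK Km.
move=> x _; rewrite (_ : (u m - (u N - Ell2 hB)) x =
  u m x - (u N x - (u N x - h x))) // subKr //.
Unshelve. all: by end_near.
Qed.

End Norm.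

(** * The inner product *)

Section ComplexLimits.
Variables (R : realType) (T : Type) (F : set_system T).
Hypothesis FF : Filter F.

Lemma cvg_normcP (g : T -> R[i]) (l : R[i]) :
  g @ F --> l <-> (forall e : R, 0 < e -> \forall t \near F, nc (l - g t) <= e).
Proof.
split=> [/cvgrPdist_le gl e e0|gl].
  have : 0 < e%:C by rewrite ltcR.
  by move/gl; apply: filterS => t; rewrite normr_normc lecR.
apply/cvgrPdist_le => -[e e'] /[!ltcE] /andP[/eqP /= -> e0].
by apply: filterS (gl e e0) => t; rewrite normr_normc lecR.
Qed.

Lemma cvg_complex (g : T -> R[i]) (a b : R) :
  (fun t => Re (g t)) @ F --> a -> (fun t => Im (g t)) @ F --> b ->
  g @ F --> (a +i* b).
Proof.
move=> /cvgrPdist_le ga /cvgrPdist_le gb; apply/cvg_normcP => e e0.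
have e2 : 0 < e / 2 by rewrite divr_gt0.
near=> t; rewrite [e]splitr.
have -> : a +i* b - g t = (a - Re (g t))%:C + 'i%C * (b - Im (g t))%:C.
  by case: (g t) => c d; simpc.
apply: le_trans (le_normcD _ _) _; rewrite Normc.normcM.
rewrite normc_i mul1r !normcR.
by apply: lerD; near: t; [exact: ga|exact: gb].
Unshelve. all: by end_near.
Qed.

End ComplexLimits.

Section Inner.
Variables (R : realType) (X : choiceType).
Implicit Types (u v w : ell2 R X) (A : {fset X}).

Import summability.
#[local] Existing Instance totally_filter.

Lemma finsum_cvg u :
  (fun A => \sum_(x <- A) nc (u x) ^+ 2) @ totally --> ell2_norm u ^+ 2.
Proof.
apply/cvgrPdist_lt => e /(ell2_norm_approx u)[A uA]; exists A => // B /= AB.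
rewrite ger0_norm ?subr_ge0 ?finsum_norm // ltrBlDl -ltrBlDr.
exact: lt_le_trans uA (finsum_mono u AB).
Qed.

(** By polarisation the partial sums of the inner product are combinations of
    partial sums of squared norms, which converge because they are monotone. *)
Lemma inner_cvg_polar u v :
  partial_sum (fun x => u x * (v x)^*%C) @ totally -->
    ((ell2_norm (u + v) ^+ 2 - ell2_norm (u - v) ^+ 2) / 4) +i*
    ((ell2_norm (u + 'i%C *: v) ^+ 2 - ell2_norm (u - 'i%C *: v) ^+ 2) / 4).
Proof.
have polar w (G : R[i] -> R) : (forall x, G (u x * (v x)^*%C) =
      (nc ((u + w) x) ^+ 2 - nc ((u - w) x) ^+ 2) / 4) ->
    G 0 = 0 -> {morph G : a b / a + b} ->
    (fun A => G (partial_sum (fun x => u x * (v x)^*%C) A)) @ totally -->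
      (ell2_norm (u + w) ^+ 2 - ell2_norm (u - w) ^+ 2) / 4.
  move=> Gx G0 GD.
  have -> : (fun A => G (partial_sum (fun x => u x * (v x)^*%C) A)) =
      (fun A => (\sum_(x <- A) nc ((u + w) x) ^+ 2 -
                 \sum_(x <- A) nc ((u - w) x) ^+ 2) / 4).
    apply/funext => A; rewrite /partial_sum.
    rewrite -(big_seq_fsetE _ A predT (fun x => u x * (v x)^*%C)) /=.
    rewrite (big_morph G GD G0); under eq_bigr do rewrite Gx.
    by rewrite -mulr_suml big_split /= sumrN.
  by apply: cvgMl; apply: cvgB; exact: finsum_cvg.
apply: cvg_complex; apply: polar => //.
- move=> x; rewrite !ell2D !ell2N !sqr_nc; case: (u x) (v x) => a b [c d] /=.
  by field.
- by move=> [a b] [c d].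
- move=> x; rewrite !ell2D !ell2N !ell2Z !sqr_nc; case: (u x) (v x) => a b [c d] /=.
  by field.
- by move=> [a b] [c d].
Qed.

Lemma inner_polar u v : inner u v =
  ((ell2_norm (u + v) ^+ 2 - ell2_norm (u - v) ^+ 2) / 4) +i*
    ((ell2_norm (u + 'i%C *: v) ^+ 2 - ell2_norm (u - 'i%C *: v) ^+ 2) / 4).
Proof. exact: cvg_lim (@inner_cvg_polar u v). Qed.

Lemma inner_cvg u v :
  partial_sum (fun x => u x * (v x)^*%C) @ totally --> inner u v.
Proof. by rewrite inner_polar; exact: inner_cvg_polar. Qed.

Lemma innerDl u v w : inner (u + v) w = inner u w + inner v w.
Proof.
apply: cvg_lim => //.
have -> : partial_sum (fun x => (u + v) x * (w x)^*%C) =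
    (fun A => partial_sum (fun x => u x * (w x)^*%C) A +
              partial_sum (fun x => v x * (w x)^*%C) A).
  apply/funext => A; rewrite /partial_sum -big_split; apply: eq_bigr => x _.
  by rewrite ell2D mulrDl.
by apply: cvgD; exact: inner_cvg.
Qed.

Lemma innerZl c u v : inner (c *: u) v = c * inner u v.
Proof.
apply: cvg_lim => //.
have -> : partial_sum (fun x => (c *: u) x * (v x)^*%C) =
    (fun A => c * partial_sum (fun x => u x * (v x)^*%C) A).
  apply/funext => A; rewrite /partial_sum mulr_sumr; apply: eq_bigr => x _.
  by rewrite ell2Z mulrA.
by apply: cvgMr; exact: inner_cvg.
Qed.

Lemma inner_conj u v : inner v u = (inner u v)^*%C.
Proof.
have sqri : 'i%C * 'i%C = - 1 :> R[i] by rewrite -expr2 sqr_i.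
have flip1 : ell2_norm (v + 'i%C *: u) = ell2_norm (u - 'i%C *: v).
  have -> : v + 'i%C *: u = 'i%C *: (u - 'i%C *: v).
    by rewrite scalerBr scalerA sqri scaleN1r opprK addrC.
  by rewrite ell2_normZ normc_i mul1r.
have flip2 : ell2_norm (v - 'i%C *: u) = ell2_norm (u + 'i%C *: v).
  have -> : u + 'i%C *: v = 'i%C *: (v - 'i%C *: u).
    by rewrite scalerBr scalerA sqri scaleN1r opprK addrC.
  by rewrite ell2_normZ normc_i mul1r.
rewrite !inner_polar /= flip1 flip2 [v + u]addrC (ell2_normB_sym v u).
by congr (_ +i* _); field.
Qed.

Lemma inner_norm u : inner u u = (ell2_norm u ^+ 2)%:C.
Proof.
rewrite inner_polar subrr ell2_norm0 expr0n subr0.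
have -> : u + u = (2%:R : R)%:C *: u.
  by rewrite rmorph_nat scaler_nat mulr2n.
have -> : u + 'i%C *: u = (1 + 'i%C) *: u by rewrite scalerDl scale1r.
have -> : u - 'i%C *: u = (1 - 'i%C) *: u by rewrite scalerBl scale1r.
by rewrite !ell2_normZ !exprMn !sqr_nc /=; congr (_ +i* _); field.
Qed.

Lemma sqr_ell2_normD u v :
  ell2_norm (u + v) ^+ 2 = ell2_norm u ^+ 2 + 2 * Re (inner u v) + ell2_norm v ^+ 2.
Proof.
have := inner_norm (u + v).
rewrite innerDl [inner u (_ + _)]inner_conj [inner v (_ + _)]inner_conj !innerDl.
rewrite (inner_conj u v) !inner_norm; case: (inner u v) => a b /=.
by move/(congr1 (fun z => Re z)) => /= <-; ring.
Qed.

Lemma sqr_ell2_normB u v :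
  ell2_norm (u - v) ^+ 2 = ell2_norm u ^+ 2 - 2 * Re (inner u v) + ell2_norm v ^+ 2.
Proof.
rewrite sqr_ell2_normD ell2_normN -scaleN1r inner_conj innerZl inner_conj.
by case: (inner u v) => a b /=; ring.
Qed.

(** Equivalent to the triangle inequality, which convexity of the square gave
    without the inner product. *)
Lemma cauchy_schwarz u v : Re (inner u v) <= ell2_norm u * ell2_norm v.
Proof.
have : ell2_norm (u + v) ^+ 2 <= (ell2_norm u + ell2_norm v) ^+ 2.
  by rewrite ler_sqr ?nnegrE ?addr_ge0 ?ell2_norm_ge0 // ell2_normD.
rewrite sqr_ell2_normD; nra.
Qed.

End Inner.

(** * Resolvents and the spectrum of a selfadjoint operator *)

Definition bounded_by (R : realType) (X Y : choiceType) (M : R)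
    (T : ell2 R X -> ell2 R Y) : Prop :=
  forall u, ell2_norm (T u) <= M * ell2_norm u.

Section Linear.
Variables (R : realType) (X Y : choiceType) (T : ell2 R X -> ell2 R Y).
Hypothesis lT : linear T.

Lemma lin_add u v : T (u + v) = T u + T v.
Proof. by rewrite -{1}[u]scale1r lT scale1r. Qed.

Lemma lin_zero : T 0 = 0.
Proof. by apply: (addrI (T 0)); rewrite -lin_add !addr0. Qed.

Lemma lin_scale c u : T (c *: u) = c *: T u.
Proof. by rewrite -[c *: u]addr0 lT lin_zero addr0. Qed.

Lemma lin_sub u v : T (u - v) = T u - T v.
Proof. by rewrite lin_add -scaleN1r lin_scale scaleN1r. Qed.

Lemma lin_sum (J : Type) (r : seq J) (P : pred J) (h : J -> ell2 R X) :
  T (\sum_(k <- r | P k) h k) = \sum_(k <- r | P k) T (h k).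
Proof. exact: (big_morph T lin_add lin_zero). Qed.

End Linear.

Section Invertibility.
Variables (R : realType) (X : choiceType).
Implicit Types (u v w : ell2 R X) (T : ell2 R X -> ell2 R X).

(** Banach's fixed point v = w + T v, by iteration from 0. *)
Lemma contraction_surj T (r : R) : linear T -> 0 <= r -> r < 1 -> bounded_by r T ->
  forall w, exists v, v - T v = w.
Proof.
move=> lT r0 r1 Tr w; pose s k := iter k (fun v => w + T v) 0.
have s_le k : ell2_norm (s k) <= ell2_norm w / (1 - r).
  elim: k => [|k IH]; first by rewrite ell2_norm0 divr_ge0 ?ell2_norm_ge0 ?subr_ge0 ?ltW.
  have -> : ell2_norm w / (1 - r) = ell2_norm w + r * (ell2_norm w / (1 - r)).
    by field; rewrite subr_eq0 gt_eqF.
  rewrite /= (le_trans (ell2_normD _ _)) // lerD2l (le_trans (Tr _)) //.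
  exact: ler_wpM2l.
have s_diff k l : ell2_norm (s (k + l)%N - s k) <= r ^+ k * (ell2_norm w / (1 - r)).
  elim: k => [|k IH]; first by rewrite add0n subr0 mul1r.
  rewrite addSn /= opprD addrACA subrr add0r -(lin_sub lT).
  by rewrite (le_trans (Tr _)) // exprS -mulrA ler_wpM2l.
have C0 : 0 <= ell2_norm w / (1 - r).
  by rewrite divr_ge0 ?ell2_norm_ge0 ?subr_ge0 ?ltW.
have [e|v sv] := ell2_complete (u := s).
  move=> e0; set C := ell2_norm w / (1 - r) in C0 s_diff.
  have : (fun k => r ^+ k * C) @ \oo --> 0 * C.
    by apply: cvgMl; apply: cvg_expr; rewrite ger0_norm.
  rewrite mul0r => /cvgrPdist_le/(_ _ e0)[N _ rN].
  have r_le k : (N <= k)%N -> r ^+ k * C <= e.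
    by move/rN; rewrite /= sub0r normrN ger0_norm // mulr_ge0 // exprn_ge0.
  exists N => m k Nm Nk; wlog mk : m k Nm Nk / (k <= m)%N.
    by move=> H; case/orP: (leq_total m k) => /H; last exact; rewrite ell2_normB_sym; exact.
  by rewrite -(subnKC mk) (le_trans (s_diff _ _)) // r_le.
exists v; apply/eqP; rewrite subr_eq -subr_eq0; apply/eqP/ell2_norm_eq0.
apply/le_anti; rewrite ell2_norm_ge0 andbT; apply/ler_addgt0Pr => e e0.
rewrite add0r; have [|N sN] := sv (e / 2); first by rewrite divr_gt0.
rewrite [e]splitr (le_trans (ell2_dist_triangle (s N.+1) _ _)) //.
apply: lerD; first by rewrite ell2_normB_sym sN.
rewrite /= opprD addrACA subrr add0r -(lin_sub lT) (le_trans (Tr _)) //.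
by rewrite (le_trans _ (sN N (leqnn N))) // ler_piMl ?ell2_norm_ge0 // ltW.
Qed.

(** A multiple of T - l at distance less than 1 from the identity makes T - l
    invertible, by the Neumann series. *)
Lemma resolvent_of_contraction T (l c : R[i]) (r : R) :
    linear T -> c != 0 -> 0 <= r -> r < 1 ->
    bounded_by r (fun u => u - c *: (T u - l *: u)) ->
  ~ spectrum T l.
Proof.
move=> lT c0 r0 r1 Kr; pose B u := T u - l *: u.
have lB : linear B.
  move=> a u v; rewrite /B lT scalerDr scalerBr !scalerA opprD addrACA.
  by rewrite [l * a]mulrC.
have lK : linear (fun u => u - c *: B u).
  move=> a u v /=; rewrite lB (scalerDr c) scalerA (scalerBr a) scalerA opprD addrACA.
  by rewrite [c * a]mulrC.
have Bbelow u : (1 - r) * ell2_norm u <= nc c * ell2_norm (B u).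
  rewrite mulrBl mul1r lerBlDr -ell2_normZ -{1}[u](subrK (c *: B u)) addrC.
  by rewrite (le_trans (ell2_normD _ _)) // lerD2l Kr.
have Binj u v : B u = B v -> u = v.
  move=> uv; apply/eqP; rewrite -subr_eq0; apply/eqP/ell2_norm_eq0.
  have := Bbelow (u - v); rewrite (lin_sub lB) uv subrr ell2_norm0 mulr0.
  rewrite pmulr_rle0 ?subr_gt0 // => uv0.
  by apply/le_anti; rewrite uv0 ell2_norm_ge0.
have Bsurj w : exists v, B v = w.
  have [v] := contraction_surj lK r0 r1 Kr (c *: w).
  by rewrite opprB addrC subrK => /(scalerI c0) <-; exists v.
have [S BS] := choice Bsurj.
apply; exists S; split => [|u|u]; last 2 first.
- by apply: Binj; rewrite BS.
- exact: BS.
split=> [a u v|]; first by apply: Binj; rewrite lB !BS.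
exists (nc c / (1 - r)) => u.
by rewrite mulrAC ler_pdivlMr ?subr_gt0 // mulrC -{2}(BS u) Bbelow.
Qed.

Lemma Im_inner_selfadjoint T u : selfadjoint T -> Im (inner u (T u)) = 0.
Proof.
move=> sT; have := inner_conj u (T u); rewrite sT.
case: (inner u (T u)) => a b [] /=; lra.
Qed.

(** The operator T - l is within a contraction of a multiple of the identity for
    l outside the segment: by size when |l| > M, and when Im l is nonzero because
    then i(T - l) has the constant nonzero real part Im l. *)
Lemma spectrum_selfadjoint T (M : R) (l : R[i]) :
    linear T -> selfadjoint T -> 0 <= M -> bounded_by M T -> spectrum T l ->
  exists2 t : R, l = t%:C & `|t| <= M.
Proof.
move=> lT sT M0 TM spl.
have l_le : nc l <= M.
  rewrite leNgt; apply/negP => Ml; have l0 : 0 < nc l by exact: le_lt_trans Ml.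
  have ln0 : l != 0 by apply: contraTneq l0 => ->; rewrite Normc.normc0 ltxx.
  apply: (@resolvent_of_contraction T l (- l^-1) (M / nc l)) spl => //.
  - by rewrite oppr_eq0 invr_eq0.
  - by rewrite divr_ge0 // ltW.
  - by rewrite ltr_pdivrMr // mul1r.
  move=> u; rewrite scaleNr opprK scalerBr scalerA mulVf // scale1r addrC subrK.
  rewrite ell2_normZ Normc.normcV [leRHS]mulrAC [leRHS]mulrC.
  by apply: ler_wpM2l; rewrite ?invr_ge0 ?(ltW l0) ?TM.
suff Iml : Im l = 0.
  exists (Re l); first by case: l Iml {spl l_le} => a b /= ->.
  exact: le_trans (normr_Re_le l) l_le.
apply/eqP/negPn/negP => b0.
case: l spl b0 {l_le} => a b spl /= b0.
pose Q := b ^+ 2 + (M + `|a|) ^+ 2.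
have b20 : 0 < b ^+ 2 by rewrite lt_neqAle sqr_ge0 andbT eq_sym sqrf_eq0.
have Q0 : 0 < Q by rewrite ltr_pwDl ?sqr_ge0.
(* s minimises (1 - s b)^2 + s^2 (M + |a|)^2, which bounds |u - i s (T - l) u|^2
   for unit u. *)
pose s := b / Q.
have r1 : 1 - b ^+ 2 / Q < 1 by rewrite ltrBlDr ltrDl divr_gt0.
have r0 : 0 <= 1 - b ^+ 2 / Q.
  by rewrite subr_ge0 ler_pdivrMr // mul1r lerDl sqr_ge0.
apply: (@resolvent_of_contraction T _ ('i%C * s%:C) (Num.sqrt (1 - b ^+ 2 / Q))) spl => //.
- rewrite mulf_eq0 negb_or; apply/andP; split.
    by rewrite eq_complex /= negb_and oner_eq0 orbT.
  by rewrite eq_complex /= eqxx andbT mulf_eq0 invr_eq0 negb_or b0 gt_eqF.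
- by rewrite -[ltRHS]sqrtr1 ltr_sqrt.
move=> u; pose A := T u - a%:C *: u.
have ImA : Im (inner u A) = 0.
  rewrite inner_conj innerDl -scaleNr innerZl inner_norm inner_conj.
  have := Im_inner_selfadjoint u sT; case: (inner u (T u)) => x z /= ->.
  by rewrite !mulr0 /=; ring.
have -> : u - ('i%C * s%:C) *: (T u - (a +i* b) *: u) =
    (1 - s * b)%:C *: u - ('i%C * s%:C) *: A.
  apply: ell2P => x; rewrite /A !(ell2D, ell2N, ell2Z).
  by case: (u x) (T u x) => c d [c' d']; simpc; congr (_ +i* _); ring.
rewrite -ler_sqr ?nnegrE ?mulr_ge0 ?sqrtr_ge0 ?ell2_norm_ge0 //.
rewrite [leRHS]exprMn (sqr_sqrtr r0) sqr_ell2_normB !ell2_normZ.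
have -> : Re (inner ((1 - s * b)%:C *: u) (('i%C * s%:C) *: A)) = 0.
  rewrite innerZl inner_conj innerZl; move: ImA; rewrite inner_conj.
  by case: (inner A u) => x z /= /eqP; rewrite oppr_eq0 => /eqP ->; ring.
rewrite Normc.normcM normc_i.
have A_le : ell2_norm A <= (M + `|a|) * ell2_norm u.
  rewrite mulrDl (le_trans (ell2_normB _ _)) // ell2_normZ normcR.
  by rewrite lerD2r TM.
rewrite mul1r !normcR !exprMn !real_normK ?num_real // mulr0 subr0.
have sA : s ^+ 2 * ell2_norm A ^+ 2 <= s ^+ 2 * ((M + `|a|) ^+ 2 * ell2_norm u ^+ 2).
  rewrite ler_wpM2l ?sqr_ge0 // -exprMn ler_sqr ?nnegrE ?ell2_norm_ge0 //.
  by rewrite mulr_ge0 ?ell2_norm_ge0 // addr_ge0.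
apply: le_trans (lerD (lexx _) sA) _; rewrite mulrA -mulrDl.
rewrite ler_wpM2r ?sqr_ge0 // le_eqVlt; apply/orP; left; apply/eqP.
rewrite /s (_ : (M + `|a|) ^+ 2 = Q - b ^+ 2); last by rewrite /Q; ring.
by field; rewrite gt_eqF.
Qed.

End Invertibility.

(** * Polynomials in a selfadjoint operator *)

Section PolynomialCalculus.
Variables (R : realType) (X : choiceType) (T : ell2 R X -> ell2 R X) (M : R).
Hypothesis lT : linear T.
Implicit Types (u v : ell2 R X) (p q : {poly R[i]}).

Lemma op_horner_widen p k u : (size p <= k)%N ->
  op_horner p T u = \sum_(l < k) p`_l *: iter l T u.
Proof.
move=> pk; rewrite /op_horner (big_ord_widen _ (fun l => p`_l *: iter l T u) pk).
rewrite big_mkcond; apply: eq_bigr => l _; case: ltnP => // pl.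
by rewrite nth_default // scale0r.
Qed.

Lemma op_hornerD p q u : op_horner (p + q) T u = op_horner p T u + op_horner q T u.
Proof.
pose k := maxn (size p) (size q).
rewrite (op_horner_widen _ (size_polyD p q)) (@op_horner_widen p k) ?leq_maxl //.
rewrite (@op_horner_widen q k) ?leq_maxr // -big_split; apply: eq_bigr => l _.
by rewrite coefD scalerDl.
Qed.

Lemma op_hornerZ c p u : op_horner (c *: p) T u = c *: op_horner p T u.
Proof.
rewrite (op_horner_widen _ (size_scale_leq c p)) /op_horner scaler_sumr.
by apply: eq_bigr => l _; rewrite coefZ scalerA.
Qed.

Lemma op_hornerB p q u : op_horner (p - q) T u = op_horner p T u - op_horner q T u.
Proof. by rewrite op_hornerD -scaleN1r op_hornerZ scaleN1r. Qed.

Lemma op_hornerC c u : op_horner c%:P T u = c *: u.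
Proof. by rewrite (op_horner_widen _ (size_polyC_leq1 c)) big_ord1 coefC. Qed.

Lemma op_hornerMX p u : op_horner (p * 'X) T u = op_horner p T (T u).
Proof.
rewrite (@op_horner_widen _ (size p).+1); last first.
  by apply: leq_trans (size_polyMleq _ _) _; rewrite size_polyX addn2.
rewrite big_ord_recl coefMX eqxx scale0r add0r; apply: eq_bigr => l _.
by rewrite coefMX /= -iterSr.
Qed.

Lemma op_hornerX u : op_horner 'X T u = T u.
Proof. by rewrite -['X]mul1r op_hornerMX op_hornerC scale1r. Qed.

Lemma iter_linear k : linear (iter k T).
Proof. by elim: k => // k IH a u v; rewrite !iterS IH lT. Qed.

Lemma op_horner_linear p : linear (op_horner p T).
Proof.
move=> a u v; rewrite /op_horner scaler_sumr -big_split; apply: eq_bigr => l _.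
by rewrite iter_linear scalerDr !scalerA [a * _]mulrC.
Qed.

Lemma op_hornerM p q u : op_horner (p * q) T u = op_horner p T (op_horner q T u).
Proof.
elim/poly_ind: q u => [|q c IH] u.
  rewrite mulr0 -[0]/(0%:P) !op_hornerC !scale0r.
  by rewrite (lin_zero (op_horner_linear p)).
rewrite mulrDr mulrA !op_hornerD !op_hornerMX IH mulrC mul_polyC.
rewrite op_hornerZ op_hornerC (lin_add (op_horner_linear p)).
by rewrite (lin_scale (op_horner_linear p)).
Qed.

Hypotheses (M0 : 0 <= M) (TM : bounded_by M T).

Lemma iter_bounded k : bounded_by (M ^+ k) (iter k T).
Proof.
elim: k => [|k IH] u; first by rewrite mul1r.
by rewrite iterS exprS -mulrA (le_trans (TM _)) // ler_wpM2l.
Qed.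

Lemma op_horner_bounded p : exists2 B : R, 0 <= B & bounded_by B (op_horner p T).
Proof.
exists (\sum_(l < size p) nc p`_l * M ^+ l).
  by apply: sumr_ge0 => l _; rewrite mulr_ge0 ?normc_ge0 ?exprn_ge0.
move=> u; rewrite (le_trans (ell2_norm_sum _ _ _)) // mulr_suml.
apply: ler_sum => l _; rewrite ell2_normZ -mulrA ler_wpM2l ?normc_ge0 //.
exact: iter_bounded.
Qed.

Hypothesis sT : selfadjoint T.

Lemma inner_sum_l (J : Type) (r : seq J) (h : J -> ell2 R X) v :
  inner (\sum_(k <- r) h k) v = \sum_(k <- r) inner (h k) v.
Proof.
elim/big_rec2: _ => [|k s u _ <-]; last by rewrite innerDl.
by rewrite -(scale0r (0 : ell2 R X)) innerZl mul0r.
Qed.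

Lemma iter_selfadjoint k : selfadjoint (iter k T).
Proof. by elim: k => // k IH u v; rewrite iterS sT IH -iterSr. Qed.

Lemma op_horner_adjoint p u v :
  inner (op_horner p T u) v = inner u (op_horner (map_poly (@conjc R) p) T v).
Proof.
rewrite [RHS]inner_conj (@op_horner_widen (map_poly _ p) (size p)) ?size_poly //.
rewrite /op_horner !inner_sum_l rmorph_sum; apply: eq_bigr => l _.
rewrite !innerZl coef_map rmorphM /= conjcK iter_selfadjoint.
by rewrite -inner_conj.
Qed.

Lemma factor_bounded_below z : ~ spectrum T z ->
  exists2 m : R, 0 < m & forall u, m * ell2_norm u <= ell2_norm (T u - z *: u).
Proof.
move=> /contrapT[S [[_ [B SB]] ST _]]; exists (Num.max B 1)^-1.
  by rewrite invr_gt0 lt_max ltr01 orbT.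
move=> u; rewrite ler_pdivrMl ?lt_max ?ltr01 ?orbT // -{1}(ST u).
apply: le_trans (SB _) _; rewrite ler_wpM2r ?ell2_norm_ge0 //.
by rewrite le_max lexx.
Qed.

Lemma product_bounded_below (r : seq R[i]) : (forall z, z \in r -> ~ spectrum T z) ->
  exists2 m : R, 0 < m & forall u,
    m * ell2_norm u <= ell2_norm (op_horner (\prod_(z <- r) ('X - z%:P)) T u).
Proof.
elim: r => [|z r IH] rT.
  by exists 1 => // u; rewrite big_nil op_hornerC scale1r mul1r.
have [m m0 rm] : exists2 m : R, 0 < m & forall u,
    m * ell2_norm u <= ell2_norm (op_horner (\prod_(z <- r) ('X - z%:P)) T u).
  by apply: IH => w wr; apply: rT; rewrite in_cons wr orbT.
have [k k0 zk] := factor_bounded_below (rT z (mem_head _ _)).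
exists (k * m) => [|u]; first exact: mulr_gt0.
rewrite big_cons op_hornerM op_hornerB op_hornerX op_hornerC.
by apply: le_trans (zk _); rewrite -mulrA ler_wpM2l // ltW.
Qed.

(** The complex field being algebraically closed, p(T) is a product of factors
    T - z, each of them bounded below when its z is off the spectrum. *)
Lemma poly_bounded_below p : p != 0 -> (forall z, root p z -> ~ spectrum T z) ->
  exists2 m : R, 0 < m & forall u, m * ell2_norm u <= ell2_norm (op_horner p T u).
Proof.
have [r pr] := closed_field_poly_normal p; move=> p0 pT.
have [|m m0 rm] := @product_bounded_below r.
  move=> z zr; apply: pT; rewrite pr rootZ ?lead_coef_eq0 //.
  by rewrite root_prod_XsubC.
have l0 : 0 < nc (lead_coef p).
  rewrite lt_neqAle normc_ge0 andbT eq_sym; apply: contra_neq p0 => /Normc.eq0_normc.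
  by move/eqP; rewrite lead_coef_eq0 => /eqP.
exists (nc (lead_coef p) * m) => [|u]; first exact: mulr_gt0.
by rewrite pr op_hornerZ ell2_normZ -pr -mulrA ler_wpM2l // ltW.
Qed.

Lemma exists_op_norm p : exists2 c : R, 0 <= c &
  bounded_by c (op_horner p T) /\
  forall d, 0 <= d -> bounded_by d (op_horner p T) -> c <= d.
Proof.
have [B B0 pB] := op_horner_bounded p.
pose E := [set ell2_norm (op_horner p T u) | u in [set u | ell2_norm u <= 1]].
have E0 : E 0.
  exists 0; rewrite /= ?ell2_norm0 //.
  by rewrite (lin_zero (op_horner_linear p)) ell2_norm0.
have E_le d : 0 <= d -> bounded_by d (op_horner p T) -> ubound E d.
  move=> d0 pd _ [u /= u1 <-]; apply: le_trans (pd u) _.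
  by rewrite ler_piMr.
have supE : has_sup E by split; [exists 0|exists B; exact: E_le].
exists (sup E); first by exact: sup_upper_bound.
split=> [u|d d0 pd]; last by apply: ge_sup; [exists 0|exact: E_le].
have [u0|u0] := eqVneq (ell2_norm u) 0.
  rewrite u0 (ell2_norm_eq0 u0) (lin_zero (op_horner_linear p)).
  by rewrite ell2_norm0 mulr0.
have nu : 0 < ell2_norm u by rewrite lt_neqAle eq_sym u0 ell2_norm_ge0.
rewrite -ler_pdivrMr //; apply: sup_upper_bound => //.
have nV : nc ((ell2_norm u)^-1)%:C = (ell2_norm u)^-1.
  by rewrite normcR ger0_norm // invr_ge0 ltW.
exists (((ell2_norm u)^-1)%:C *: u) => /=.
  by rewrite ell2_normZ nV mulVf.
by rewrite (lin_scale (op_horner_linear p)) ell2_normZ nV mulrC.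
Qed.

Local Notation conjp := (map_poly (@conjc R)).

Lemma conjp_hornerR q (t : R) : (conjp q).[t%:C] = (q.[t%:C])^*%C.
Proof. by rewrite -[in LHS](conjc_real t) horner_map. Qed.

Lemma mulJc (z : R[i]) : z^*%C * z = (nc z ^+ 2)%:C.
Proof. by rewrite mulrC -sqr_normc normr_normc rmorphXn. Qed.

(** c^2 - q(T)* q(T) is not bounded below, c being the norm of q(T), so that one
    of its linear factors is not invertible: the corresponding root t lies in the
    spectrum and has |q(t)| = c. *)
Lemma op_norm_attained q (c e : R) : c%:C ^+ 2 *: 1 - conjp q * q != 0 ->
    0 <= c -> bounded_by c (op_horner q T) ->
    (forall d, 0 <= d -> bounded_by d (op_horner q T) -> c <= d) ->
    (forall t : R, spectrum T t%:C -> nc q.[t%:C] <= e) ->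
  0 <= e -> c <= e.
Proof.
set P := _ - _ => P0 c0 qc c_le qe e0; rewrite leNgt; apply/negP => ec.
have cgt0 : 0 < c by exact: le_lt_trans ec.
have [|m m0 Pm] := poly_bounded_below P0.
  move=> z; rewrite rootE /P !hornerE => /eqP Pz /[dup] spz.
  move=> /(spectrum_selfadjoint lT sT M0 TM)[t zt _]; move: spz Pz; rewrite zt.
  move=> /qe qt; rewrite conjp_hornerR mulJc -rmorphXn -rmorphB => -[/eqP].
  rewrite subr_eq0 eqrXn2 ?normc_ge0 // => /eqP cq.
  by move: qt; rewrite -cq leNgt ec.
have Sstar v : ell2_norm (op_horner (conjp q) T v) <= c * ell2_norm v.
  set w := op_horner _ _ v.
  have [->|w0] := eqVneq (ell2_norm w) 0; first by rewrite mulr_ge0 ?ell2_norm_ge0.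
  have wgt0 : 0 < ell2_norm w by rewrite lt_neqAle eq_sym w0 ell2_norm_ge0.
  rewrite -(ler_pM2l wgt0) -expr2.
  have -> : ell2_norm w ^+ 2 = Re (inner (op_horner q T w) v).
    by rewrite op_horner_adjoint -/w inner_norm.
  apply: le_trans (cauchy_schwarz _ _) _; rewrite mulrA [_ * c]mulrC.
  by rewrite ler_wpM2r ?ell2_norm_ge0.
(* With S = q(T): m^2 |u|^2 <= |(c^2 - S* S) u|^2 <= c^2 (c^2 |u|^2 - |S u|^2), so
   that S has norm less than c. *)
have key u : ell2_norm (op_horner q T u) ^+ 2 <=
    (c ^+ 2 - m ^+ 2 / c ^+ 2) * ell2_norm u ^+ 2.
  set S := ell2_norm (op_horner q T u); set U := ell2_norm u.
  have : m ^+ 2 * U ^+ 2 <= c ^+ 4 * U ^+ 2 - c ^+ 2 * S ^+ 2.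
    rewrite -exprMn; apply: (@le_trans _ _ (ell2_norm (op_horner P T u) ^+ 2)).
      by rewrite ler_sqr ?nnegrE ?Pm ?mulr_ge0 ?ell2_norm_ge0 // ltW.
    rewrite /P op_hornerB op_hornerZ op_hornerM -[1]/(1%:P) op_hornerC scale1r.
    rewrite sqr_ell2_normB ell2_normZ innerZl.
    have -> : Re (c%:C ^+ 2 * inner u (op_horner (conjp q) T (op_horner q T u))) =
        c ^+ 2 * S ^+ 2.
      by rewrite -op_horner_adjoint inner_norm -rmorphXn -rmorphM.
    rewrite -rmorphXn normcR ger0_norm ?sqr_ge0 //.
    have : ell2_norm (op_horner (conjp q) T (op_horner q T u)) ^+ 2 <= (c * S) ^+ 2.
      by rewrite ler_sqr ?nnegrE ?mulr_ge0 ?ell2_norm_ge0 // Sstar.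
    rewrite -/U !exprMn; set Z := ell2_norm _ ^+ 2.
    by lra.
  move=> h; rewrite -(ler_pM2l (exprn_gt0 2 cgt0)) [leRHS]mulrA.
  have -> : c ^+ 2 * (c ^+ 2 - m ^+ 2 / c ^+ 2) = c ^+ 4 - m ^+ 2.
    by field; rewrite gt_eqF.
  by rewrite mulrBl; lra.
have : c <= Num.sqrt (c ^+ 2 - m ^+ 2 / c ^+ 2).
  apply: c_le => [|u]; first exact: sqrtr_ge0.
  rewrite -[ell2_norm u]ger0_norm ?ell2_norm_ge0 // -sqrtr_sqr.
  rewrite mulrC -sqrtrM ?sqr_ge0 // -[leLHS]ger0_norm ?ell2_norm_ge0 // -sqrtr_sqr.
  by rewrite ler_wsqrtr // mulrC.
apply/negP; rewrite -ltNge -[ltRHS]ger0_norm // -[ltRHS]sqrtr_sqr.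
rewrite ltr_sqrt ?exprn_gt0 // ltrBlDr ltrDl.
by rewrite divr_gt0 ?exprn_gt0.
Qed.

(** Were the spectrum empty, the norm of T itself would be 0; but 0 is in the
    spectrum of the zero operator of a nonzero space. *)
Lemma spectrum_nonempty u : u != 0 -> exists t : R, spectrum T t%:C.
Proof.
move=> u0; apply: contrapT => /forallNP nosp.
have [c c0 [Xc c_le]] := exists_op_norm 'X.
have cX : c <= 0.
  apply: (op_norm_attained _ c0 Xc c_le) => // [|t /nosp //].
  rewrite map_polyX -expr2 subr_eq0; apply/negP => /eqP cX.
  by have := size_scale_leq (c%:C ^+ 2) 1; rewrite cX size_polyXn size_poly1.
have T0 v : T v = 0.
  apply: ell2_norm_eq0; apply/le_anti; rewrite ell2_norm_ge0 andbT.
  by rewrite -op_hornerX (le_trans (Xc v)) // mulr_le0_ge0 // ell2_norm_ge0.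
have := nosp 0; move/contrapT => [S [_ ST _]].
have S0 v : S 0 = v by rewrite -[RHS]ST T0 scale0r subr0.
by move: u0; rewrite -(S0 u) (S0 0) eqxx.
Qed.

(** The factorisation argument needs a nonzero polynomial. If c^2 - conj(q) q is
    zero then |q| is constantly c on the real line, hence at a spectral point. *)
Lemma spectral_bound q (e : R) : 0 <= e ->
    (forall t : R, spectrum T t%:C -> nc q.[t%:C] <= e) ->
  bounded_by e (op_horner q T).
Proof.
move=> e0 qe u; have [c c0 [qc c_le]] := exists_op_norm q.
have [->|u0] := eqVneq u 0.
  by rewrite (lin_zero (op_horner_linear q)) ell2_norm0 mulr0.
apply: le_trans (qc u) _; rewrite ler_wpM2r ?ell2_norm_ge0 //.
have [P0|P0] := eqVneq (c%:C ^+ 2 *: 1 - conjp q * q) 0; last first.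
  exact: (op_norm_attained P0 c0 qc c_le qe e0).
have [t spt] := spectrum_nonempty u0.
have := congr1 (horner^~ t%:C) P0; rewrite !hornerE conjp_hornerR mulJc.
rewrite -rmorphXn -rmorphB => -[/eqP]; rewrite subr_eq0.
rewrite eqrXn2 ?normc_ge0 // => /eqP ->; exact: qe.
Qed.

End PolynomialCalculus.

(** * Weierstrass approximation by Bernstein polynomials *)

Section Bernstein.
Variable R : realType.
Implicit Types (g h : nat -> R) (t c : R) (k l : nat).

(** [bernstein k h] is the sum of h l 'C(k, l) X^l (1 - X)^(k - l): its value at t
    is the expectation of h at the number of successes in k independent trials of
    probability t, and the recursion conditions on the first trial. *)
Fixpoint bernstein k h : {poly R} :=
  if k is l.+1 then
    'X * bernstein l (h \o succn) + (1 - 'X) * bernstein l h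
  else (h 0%N)%:P.

Lemma bernstein_step k h t : (bernstein k.+1 h).[t] =
  t * (bernstein k (h \o succn)).[t] + (1 - t) * (bernstein k h).[t].
Proof. by rewrite /= !hornerE. Qed.

Lemma bernstein_norm_le k g h t : 0 <= t <= 1 ->
  (forall l, (l <= k)%N -> `|g l| <= h l) ->
  `|(bernstein k g).[t]| <= (bernstein k h).[t].
Proof.
move=> /andP[t0 t1]; elim: k g h => [|k IH] g h gh; first by rewrite !hornerC gh.
rewrite !bernstein_step (le_trans (ler_normD _ _)) // !normrM.
rewrite (ger0_norm t0) (ger0_norm (x := 1 - t)) ?subr_ge0 //.
apply: lerD; apply: ler_wpM2l; rewrite ?subr_ge0 //; apply: IH => l lk.
  exact: gh.
exact: gh (leqW lk).
Qed.

Lemma bernsteinB k g c t :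
  (bernstein k g).[t] - c = (bernstein k (fun l => g l - c)).[t].
Proof.
elim: k g => [|k IH] g; first by rewrite !hornerC.
by rewrite !bernstein_step -!IH; ring.
Qed.

(** Variance plus squared bias of a binomial variable. At c = k t the bias vanishes;
    the induction needs every c, because the first trial shifts it by 1. *)
Lemma bernstein_variance k (a b c t : R) :
  (bernstein k (fun l => a + b * (l%:R - c) ^+ 2)).[t] =
  a + b * (k%:R * t * (1 - t) + (k%:R * t - c) ^+ 2).
Proof.
elim: k c => [|k IH] c; first by rewrite hornerC !mul0r sub0r add0r sqrrN.
rewrite bernstein_step IH.
have -> : (fun l => a + b * (l%:R - c) ^+ 2) \o succn =
    (fun l => a + b * (l%:R - (c - 1)) ^+ 2).
  by apply/funext => l /=; rewrite -natr1 opprB addrA addrAC.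
by rewrite IH -natr1; ring.
Qed.

End Bernstein.

Section Weierstrass.
Variable R : realType.
Implicit Types (f : R -> R) (M e t s : R).

Lemma continuous_bounded f M : continuous f ->
  exists K, forall t, `|t| <= M -> `|f t| <= K.
Proof.
move=> fc; have /compact_near_coveringP cov := @segment_compact R (- M) M.
have [|K [_ fK]] := cov R +oo%R (fun K t => `|f t| <= K) _.
  move=> t _; exists ([set s | `|f s| <= `|f t| + 1], [set K | `|f t| + 1 <= K]).
    split => /=; last exact: nbhs_pinfty_ge (num_real _).
    have /cvgrPdist_le/(_ 1 ltr01) := fc t; apply: filterS => s /=.
    rewrite distrC => fst; rewrite -[X in `|X|](subrK (f t)) (le_trans (ler_normD _ _)) //.
    by rewrite addrC lerD2l.
  by move=> [s K] [] /=; exact: le_trans.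
exists (K + 1) => t tM; apply: fK; first by rewrite ltrDl.
by rewrite /= in_itv /= -ler_norml.
Qed.

(** The quantitative form of uniform continuity that the variance estimate for
    Bernstein polynomials consumes directly. *)
Lemma continuous_quadratic_modulus f M e : continuous f -> 0 < e ->
  exists2 C, 0 <= C & forall s t, `|s| <= M -> `|t| <= M ->
    `|f s - f t| <= e + C * (s - t) ^+ 2.
Proof.
move=> fc e0; have [K fK] := continuous_bounded M fc.
have /compact_near_coveringP cov := @segment_compact R (- M) M.
have [|C [_ fC]] := cov R +oo%R (fun C s => `|s| <= M -> forall t, `|t| <= M ->
    `|f s - f t| <= e + C * (s - t) ^+ 2) _.
  move=> s _; have e2 : 0 < e / 2 by rewrite divr_gt0.
  have /cvgrPdist_le/(_ _ e2)[d /= d0 fd] := fc s.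
  have d2 : 0 < d / 2 by rewrite divr_gt0.
  exists ([set s' | `|s - s'| < d / 2], [set C | (K + K) / (d / 2) ^+ 2 <= C]).
    split => /=; last exact: nbhs_pinfty_ge (num_real _).
    by exists (d / 2).
  move=> [s' C] [/= ss' CK] s'M t tM.
  have C0 : 0 <= C.
    apply: le_trans CK; rewrite divr_ge0 ?sqr_ge0 //.
    by rewrite addr_ge0 // (le_trans _ (fK t tM)).
  have [st|st] := ltP `|s - t| d.
    apply: ler_wpDr; first by rewrite mulr_ge0 ?sqr_ge0.
    rewrite (splitr e) (le_trans (ler_distD (f s) _ _)) // lerD //.
      by rewrite distrC fd //= (lt_trans ss') // gtr_pMr // invf_lt1 ?ltr1n.
    exact: fd.
  have s't : d / 2 <= `|s' - t|.
    have := ler_distD s' s t; lra.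
  apply: ler_wpDl; first exact: ltW.
  apply: (@le_trans _ _ (K + K)).
    by rewrite (le_trans (ler_normB _ _)) // lerD // fK.
  rewrite -(divfK (x := (d / 2) ^+ 2) _ (K + K)) ?gt_eqF ?exprn_gt0 //.
  apply: ler_pM => //; first by rewrite divr_ge0 ?sqr_ge0 // addr_ge0 // (le_trans _ (fK t tM)).
    exact: sqr_ge0.
  by rewrite -[leRHS]real_normK ?num_real // ler_sqr ?nnegrE // ltW.
exists (`|C| + 1) => [|s t sM tM]; first by rewrite addr_ge0.
apply: fC => //; first by rewrite (le_lt_trans (ler_norm C)) // ltrDl.
by rewrite /= in_itv /= -ler_norml.
Qed.

Lemma weierstrass f M e : continuous f -> 0 < e ->
  exists p : {poly R}, forall t, `|t| <= M -> `|f t - p.[t]| <= e.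
Proof.
move=> fc e0; pose N := `|M| + 1.
have N0 : 0 < N by rewrite ltr_wpDl.
have e2 : 0 < e / 2 by rewrite divr_gt0.
have [C C0 fC] := continuous_quadratic_modulus N fc e2.
pose b := C * (2 * N) ^+ 2.
have b0 : 0 <= b by rewrite mulr_ge0 ?sqr_ge0.
(* The nodes x l cut [-N, N] into k equal parts: when l deviates from its mean k y,
   the quadratic modulus charges C (2 N / k)^2 times the squared deviation, of mean
   at most k. *)
have [k k0 bk] : exists2 k, 0 < k%:R :> R & b / k%:R <= e / 2.
  exists (Num.truncn (b / (e / 2))).+1; first by rewrite ltr0n.
  rewrite ler_pdivrMr ?ltr0n // mulrC -ler_pdivrMr //; apply/ltW.
  exact: truncnS_gt.
pose x l : R := - N + 2 * N * (l%:R / k%:R).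
exists (bernstein k (f \o x) \Po ((2 * N)^-1 *: ('X + N%:P))) => t tM.
have tN : `|t| <= N.
  by rewrite (le_trans tM) // (le_trans (ler_norm M)) // lerDl.
rewrite horner_comp hornerZ hornerD hornerX hornerC; set y := _ * (t + N).
have yt : t = - N + 2 * N * y by rewrite /y; field; rewrite gt_eqF.
have y01 : 0 <= y <= 1.
  move: tN; rewrite ler_norml => /andP[t1 t2].
  rewrite mulr_ge0 /=; last by rewrite -lerBlDr sub0r.
    by rewrite ler_pdivrMl ?mulr_gt0 // mulr1; lra.
  by rewrite invr_ge0 mulr_ge0 // ltW.
rewrite distrC bernsteinB.
apply: le_trans (bernstein_norm_le (h := fun l => e / 2 + b / k%:R ^+ 2 *
    (l%:R - k%:R * y) ^+ 2) y01 _) _ => [l lk|].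
  have xN : `|x l| <= N.
    have : l%:R / k%:R <= 1 :> R by rewrite ler_pdivrMr // mul1r ler_nat.
    have : 0 <= l%:R / k%:R :> R by rewrite divr_ge0 // ltW.
    rewrite ler_norml /x => z0 z1; apply/andP; split; nra.
  apply: le_trans (fC _ _ xN tN) _; rewrite lerD2l [in leLHS]yt /x /b.
  by rewrite le_eqVlt; apply/orP; left; apply/eqP; field; rewrite gt_eqF.
rewrite bernstein_variance subrr expr0n addr0 [leRHS](splitr e) lerD2l.
apply: le_trans bk; rewrite -[leRHS]mulr1.
have -> : b / k%:R ^+ 2 * (k%:R * y * (1 - y)) = b / k%:R * (y * (1 - y)).
  by field; rewrite gt_eqF.
apply: ler_wpM2l; first by rewrite mulr_ge0 // invr_ge0 ltW.
by case/andP: y01 => ? ?; nra.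
Qed.

Lemma weierstrass_complex (f : R -> R[i]) M e : continuous f -> 0 < e ->
  exists p : {poly R[i]}, forall t, `|t| <= M -> nc (p.[t%:C] - f t) <= e.
Proof.
move=> fc e0; have e2 : 0 < e / 2 by rewrite divr_gt0.
have parts (G : R[i] -> R) : (forall z w, `|G z - G w| <= nc (z - w)) ->
    exists p : {poly R}, forall t, `|t| <= M -> `|G (f t) - p.[t]| <= e / 2.
  move=> Gle; apply: weierstrass e2 => t; apply/cvgrPdist_le => d d0.
  have /cvg_normcP/(_ d d0) := fc t; apply: filterS => s; exact: le_trans.
have [p fp] := parts (fun z => Re z) ltac:(by move=> z w; rewrite -ReB normr_Re_le).
have [q fq] := parts (fun z => Im z) ltac:(by move=> z w; rewrite -ImB normr_Im_le).
exists (map_poly (real_complex R) p + 'i%C *: map_poly (real_complex R) q) => t tM.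
rewrite !hornerE !horner_map /= normcB_sym.
have -> : f t - (p.[t]%:C + 'i%C * q.[t]%:C) =
    (Re (f t) - p.[t])%:C + 'i%C * (Im (f t) - q.[t])%:C.
  by case: (f t) => a b; simpc.
rewrite (splitr e) (le_trans (le_normcD _ _)) // lerD //.
  by rewrite normcR fp.
by rewrite Normc.normcM normc_i mul1r normcR fq.
Qed.

End Weierstrass.

(** * The continuous functional calculus *)

Section FunctionalCalculus.
Variables (R : realType) (X : choiceType) (T : ell2 R X -> ell2 R X) (M : R).
Hypotheses (lT : linear T) (sT : selfadjoint T) (M0 : 0 <= M) (TM : bounded_by M T).
Implicit Types (f : R -> R[i]) (p q : {poly R[i]}) (Z : ell2 R X -> ell2 R X).

Lemma op_horner_dist_le p q (e : R) u : 0 <= e ->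
    (forall t : R, spectrum T t%:C -> nc (p.[t%:C] - q.[t%:C]) <= e) ->
  ell2_norm (op_horner p T u - op_horner q T u) <= e * ell2_norm u.
Proof.
move=> e0 pqe; rewrite -op_hornerB; apply: (spectral_bound lT M0 TM sT) => // t spt.
by rewrite hornerD hornerN pqe.
Qed.

Lemma real_spectrum_bounded (t : R) : spectrum T t%:C -> `|t| <= M.
Proof. by move=> /(spectrum_selfadjoint lT sT M0 TM)[s [->]]. Qed.

(** Polynomials that approximate f on [-M, M] have a Cauchy sequence of values
    at T. *)
Lemma funcalc_exists f : continuous f -> exists Z, is_funcalc f T Z.
Proof.
move=> fc; have pos k : 0 < k.+1%:R^-1 :> R by rewrite invr_gt0 ltr0n.
have [p fp] := choice (fun k => weierstrass_complex M fc (pos k)).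
have small e : 0 < e -> exists N, forall k, (N <= k)%N -> k.+1%:R^-1 <= e :> R.
  move=> e0; have : (fun k => k.+1%:R^-1) @ \oo --> (0 : R) by exact: cvg_harmonic.
  move=> /cvgrPdist_le/(_ _ e0)[N _ Ne]; exists N => k /Ne /=.
  by rewrite sub0r normrN ger0_norm.
have pp k l u : ell2_norm (op_horner (p k) T u - op_horner (p l) T u) <=
    (k.+1%:R^-1 + l.+1%:R^-1) * ell2_norm u.
  apply: op_horner_dist_le => [|t /real_spectrum_bounded tM]; first exact/ltW/addr_gt0.
  rewrite -(subrKA (f t)) (le_trans (le_normcD _ _)) // lerD ?fp //.
  by rewrite normcB_sym fp.
have lim u : exists v, forall e, 0 < e -> exists N, forall k, (N <= k)%N ->
    ell2_norm (op_horner (p k) T u - v) <= e.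
  apply: (@ell2_complete _ _ (fun k => op_horner (p k) T u)) => e e0.
  have U0 : 0 < ell2_norm u + 1 by rewrite ltr_wpDl ?ell2_norm_ge0.
  have [|N Ne] := small (e / (ell2_norm u + 1) / 2); first by rewrite !divr_gt0.
  exists N => k l /Ne ke /Ne le; apply: le_trans (pp k l u) _.
  apply: (@le_trans _ _ (e / (ell2_norm u + 1) * (ell2_norm u + 1))); last first.
    by rewrite divfK // gt_eqF.
  apply: ler_pM; [exact/ltW/addr_gt0|exact: ell2_norm_ge0| |by rewrite lerDl].
  by rewrite [leRHS]splitr lerD.
have [Z pZ] := choice lim; exists Z, p; split=> e e0.
  have [N Ne] := small e e0; exists N => // k /= Nk t /real_spectrum_bounded tM.
  exact: le_trans (fp k t tM) (Ne k Nk).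
have [|N Ne] := small (e / 2); first by rewrite divr_gt0.
exists N => // k /= Nk u; apply/ler_addgt0Pr => d d0.
have [N' Nd] := pZ u d d0; pose l := maxn N N'.
rewrite (le_trans (ell2_dist_triangle (op_horner (p l) T u) _ _)) // lerD //.
  rewrite (le_trans (pp k l u)) // ler_wpM2r ?ell2_norm_ge0 //.
  by rewrite (splitr e) lerD // Ne // leq_maxl.
by rewrite Nd // leq_maxr.
Qed.

(** The bound holds whichever approximating polynomials define f(T), because a
    polynomial in T is controlled by its values on the spectrum. *)
Lemma funcalc_approx f q (e : R) u : continuous f -> 0 < e ->
    (forall t : R, `|t| <= M -> nc (q.[t%:C] - f t) <= e) ->
  ell2_norm (op_horner q T u - funcalc f T u) <= 3 * e * ell2_norm u.
Proof.
move=> fc e0 qf; have [Z0 fZ0] := funcalc_exists fc.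
have [p [pf pZ]] : is_funcalc f T (funcalc f T) by exact: (xgetPex _ (ex_intro _ Z0 fZ0)).
have [k [pfk pZk]] := filter_ex (filterI (pf e e0) (pZ e e0)).
rewrite (le_trans (ell2_dist_triangle (op_horner (p k) T u) _ _)) //.
have -> : 3 * e * ell2_norm u = (e + e) * ell2_norm u + e * ell2_norm u by ring.
apply: lerD (pZk u); apply: op_horner_dist_le => [|t spt]; first exact/ltW/addr_gt0.
rewrite -(subrKA (f t)) (le_trans (le_normcD _ _)) // lerD ?qf //.
  exact: real_spectrum_bounded.
by rewrite normcB_sym pfk.
Qed.

End FunctionalCalculus.

(** * Tensor products and truncation *)

Section Relabel.
Variable R : realType.
Implicit Types X Y : choiceType.

Lemma finsum_norm_seq X (u : ell2 R X) (s : seq X) : uniq s ->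
  \sum_(x <- s) nc (u x) ^+ 2 <= ell2_norm u ^+ 2.
Proof.
move=> us; apply: le_trans (finsum_norm u [fset x in s]%fset).
rewrite (perm_big [fset x in s]%fset) //=; apply: uniq_perm => //.
by move=> x; rewrite inE.
Qed.

(** Restrictions, extensions by zero, slices and translations all have this form. *)
Lemma relabel_norm_le X Y (g : Y -> option X) (u : ell2 R X) (w : ell2 R Y) :
    (forall y y' x, g y = Some x -> g y' = Some x -> y = y') ->
    (forall y, w y = oapp u 0 (g y)) ->
  ell2_norm w <= ell2_norm u.
Proof.
move=> ginj wE; apply: ell2_norm_le => [|A]; first exact: ell2_norm_ge0.
have -> : \sum_(y <- A) nc (w y) ^+ 2 = \sum_(x <- pmap g A) nc (u x) ^+ 2.
  under eq_bigr do rewrite wE.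
  elim: (enum_fset A) => [|y s IH]; first by rewrite !big_nil.
  rewrite big_cons IH [pmap _ (_ :: _)]/=; case: (g y) => [x|]; first by rewrite big_cons.
  by rewrite [oapp _ _ _]/= Normc.normc0 expr0n add0r.
apply: finsum_norm_seq; have := fset_uniq A.
elim: (enum_fset A) => //= y s IH /andP[ys /IH us].
case gy: (g y) => [x|] //=; rewrite us andbT; apply: contra ys.
by rewrite mem_pmap => /mapP[y' y's /esym gy']; rewrite (ginj _ _ _ gy gy').
Qed.

Lemma ell2_norm_mono X (u w : ell2 R X) :
  (forall x, nc (u x) <= nc (w x)) -> ell2_norm u <= ell2_norm w.
Proof.
move=> uw; apply: ell2_norm_le => [|A]; first exact: ell2_norm_ge0.
apply: le_trans (finsum_norm w A); apply: ler_sum => x _.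
by rewrite ler_sqr ?nnegrE ?normc_ge0.
Qed.

Lemma ell2_norm_delta X (x : X) : ell2_norm (delta R x) <= 1.
Proof.
apply: ell2_norm_le => // A; rewrite expr1n big_mkcond /=.
have [xA|xA] := boolP (x \in A).
  rewrite (big_fsetD1 x) //= eqxx Normc.normc1 expr1n big_seq big1 ?addr0 //.
  by move=> y; rewrite !inE => /andP[/negPf -> _]; rewrite Normc.normc0 expr0n.
rewrite big_seq big1 // => y yA; case: eqP => [yx|_]; last by rewrite Normc.normc0 expr0n.
by rewrite -yx yA in xA.
Qed.

End Relabel.

Section Tensor.
Variables (R : realType) (n : nat).
Implicit Types X Y : choiceType.

Lemma slot_linear X (i : 'I_n) : linear (@slot R n X i).
Proof.
move=> a u v; apply: ell2P => -[k x]; rewrite ell2D ell2Z /=.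
by case: eqP => _ /=; rewrite ?mulr0 ?addr0.
Qed.

Lemma slice_linear X (i : 'I_n) : linear (@slice R n X i).
Proof. by move=> a u v; apply: ell2P. Qed.

Lemma slot_norm X (i : 'I_n) (u : ell2 R X) : ell2_norm (slot i u) <= ell2_norm u.
Proof.
apply: (@relabel_norm_le _ _ _ (fun p => if p.1 == i then Some p.2 else None)) => //.
move=> [i1 x1] [i2 x2] x /=.
by case: eqP => //= -> [<-]; case: eqP => //= -> [<-].
Qed.

Lemma slice_norm X (i : 'I_n) (u : ell2 R ('I_n * X)%type) :
  ell2_norm (slice i u) <= ell2_norm u.
Proof.
by apply: (@relabel_norm_le _ _ _ (fun x => Some (i, x))) => // x y p [<-] [<-].
Qed.

Lemma tens_linear X Y (a : 'M[R[i]]_n) (T : ell2 R X -> ell2 R Y) :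
  linear T -> linear (tens a T).
Proof.
move=> lT c u v; rewrite /tens scaler_sumr -big_split; apply: eq_bigr => k _.
rewrite scaler_sumr -big_split; apply: eq_bigr => l _ /=.
by rewrite slice_linear lT slot_linear scalerDr !scalerA [c * _]mulrC.
Qed.

Lemma tens_bounded X Y (a : 'M[R[i]]_n) (T : ell2 R X -> ell2 R Y) (M : R) :
  0 <= M -> bounded_by M T -> bounded_by (\sum_i \sum_j nc (a i j) * M) (tens a T).
Proof.
move=> M0 TM u; rewrite (le_trans (ell2_norm_sum _ _ _)) // mulr_suml.
apply: ler_sum => k _; rewrite (le_trans (ell2_norm_sum _ _ _)) // mulr_suml.
apply: ler_sum => l _; rewrite ell2_normZ -mulrA ler_wpM2l ?normc_ge0 //.
rewrite (le_trans (slot_norm _ _)) // (le_trans (TM _)) //.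
by rewrite ler_wpM2l // slice_norm.
Qed.

Lemma tens1E X Y (T : ell2 R X -> ell2 R Y) u (i : 'I_n) y :
  tens 1%:M T u (i, y) = T (slice i u) y.
Proof.
rewrite /tens ell2_sum (bigD1 i) //= [X in _ + X]big1 => [|k ki]; last first.
  by rewrite ell2_sum big1 // => l _; rewrite ell2Z /= eq_sym (negPf ki) mulr0.
rewrite addr0 ell2_sum (bigD1 i) // big1 => [|k ki]; last first.
  by rewrite ell2Z mxE eq_sym (negPf ki) mul0r.
by rewrite ell2Z mxE eqxx mul1r /= eqxx addr0.
Qed.

End Tensor.

Section Truncation.
Variables (R : realType) (X : choiceType) (n : nat) (A : {fset X}).

Definition restrn : ell2 R ('I_n * X)%type -> ell2 R ('I_n * A)%type :=
  tens 1%:M (@restr R X A).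
Definition extn : ell2 R ('I_n * A)%type -> ell2 R ('I_n * X)%type :=
  tens 1%:M (@ext R X A).
Definition cut (u : ell2 R ('I_n * X)%type) := extn (restrn u).

Lemma restrnE u (p : 'I_n * A) : restrn u p = u (p.1, val p.2).
Proof. by case: p => i a; rewrite /restrn tens1E. Qed.

Lemma extnE u (p : 'I_n * X) : extn u p = oapp (fun a => u (p.1, a)) 0 (insub p.2).
Proof. by case: p => i a; rewrite /extn tens1E. Qed.

Lemma cutE u (p : 'I_n * X) : cut u p = if p.2 \in A then u p else 0.
Proof.
rewrite extnE; case: insubP => [a aA ea|/negPf ->] //=.
by rewrite restrnE aA ea; case: p {aA ea}.
Qed.

Lemma restrn_linear : linear restrn.
Proof. by move=> a u v; apply: ell2P => p; rewrite ell2D ell2Z !restrnE. Qed.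

Lemma extn_linear : linear extn.
Proof.
move=> a u v; apply: ell2P => p; rewrite ell2D ell2Z !extnE.
by case: insub => [b|] /=; rewrite ?mulr0 ?addr0.
Qed.

Lemma cut_linear : linear cut.
Proof. by move=> a u v; rewrite /cut restrn_linear extn_linear. Qed.

Lemma extnK u : restrn (extn u) = u.
Proof. by apply: ell2P => -[i a]; rewrite restrnE extnE valK. Qed.

Lemma restrn_norm u : ell2_norm (restrn u) <= ell2_norm u.
Proof.
apply: (@relabel_norm_le _ _ _ (fun p => Some (p.1, val p.2))) => [|p].
  by move=> [i a] [j b] q [<-] [-> /val_inj ->].
by rewrite restrnE.
Qed.

Lemma extn_norm u : ell2_norm (extn u) = ell2_norm u.
Proof.
apply/le_anti; rewrite -{3}[u]extnK restrn_norm andbT.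
apply: (@relabel_norm_le _ _ _ (fun p => omap (fun a => (p.1, a)) (insub p.2))).
  move=> [i x] [j y] [k a] /=.
  by case: insubP => // a1 _ <- [-> ->]; case: insubP => // b1 _ <- [-> ->].
by move=> p; rewrite extnE; case: insub.
Qed.

Lemma cut_norm u : ell2_norm (cut u) <= ell2_norm u.
Proof. by rewrite extn_norm restrn_norm. Qed.

(** The extension is isometric, hence preserves inner products by polarisation;
    and against a vector supported in A, cutting u to A changes no summand. *)
Lemma restrn_adjoint u v : inner (restrn u) v = inner u (extn v).
Proof.
have extn_inner w : inner (extn w) (extn v) = inner w v.
  rewrite !inner_polar -(lin_scale extn_linear) -!(lin_add extn_linear).
  by rewrite -!(lin_sub extn_linear) !extn_norm.
rewrite -extn_inner; congr (summability.sum _); apply/funext => p.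
rewrite -/(cut u) cutE extnE; case: insubP => [a -> //|_].
by rewrite [oapp _ _ _]/= conjc0 !mulr0.
Qed.

Variables (y : ell2 R ('I_n * X)%type -> ell2 R ('I_n * X)%type) (M : R).

(** The truncate of y, over an arbitrary index type in place of a group. *)
Definition compression : ell2 R ('I_n * A)%type -> ell2 R ('I_n * A)%type :=
  fun u => restrn (y (extn u)).

Lemma compression_linear : linear y -> linear compression.
Proof. by move=> ly a u v; rewrite /compression extn_linear ly restrn_linear. Qed.

Lemma compression_bounded : bounded_by M y -> bounded_by M compression.
Proof.
move=> yM u; rewrite -(extn_norm u).
by rewrite (le_trans (restrn_norm _)).
Qed.

Lemma compression_selfadjoint : selfadjoint y -> selfadjoint compression.
Proof.
move=> sy u v; rewrite restrn_adjoint sy [RHS]inner_conj restrn_adjoint.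
by rewrite -inner_conj.
Qed.

Lemma iter_compression k u :
  iter k compression u = restrn (iter k (y \o cut) (extn u)).
Proof.
elim: k => [|k IH]; first by rewrite /= extnK.
by rewrite !iterS IH.
Qed.

(** One step of the telescoping: with P the cut and v_k, w_k the two iterates,
    v_(k+1) - w_(k+1) = y ((1 - P) v_k + P (v_k - w_k)). *)
Lemma dist_iter_compression k u : linear y -> 0 <= M -> bounded_by M y ->
  ell2_norm (iter k.+1 y u - iter k.+1 (y \o cut) u) <=
  M * (ell2_norm (iter k y u - cut (iter k y u)) +
       ell2_norm (iter k y u - iter k (y \o cut) u)).
Proof.
move=> ly M0 yM; rewrite !iterS /= -(lin_sub ly) (le_trans (yM _)) //.
rewrite ler_wpM2l // (le_trans (ell2_dist_triangle (cut (iter k y u)) _ _)) //.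
by rewrite lerD2l -(lin_sub cut_linear) cut_norm.
Qed.

End Truncation.

(** * Right translations *)

Section RightTranslation.
Variables (R : realType) (Gamma : groupType).
Implicit Types (g b : Gamma).

Lemma rho_subproof (u : ell2 R Gamma) g :
  (fun b => u (b * g)%g) \in @ell2_pred R Gamma.
Proof.
apply: (@ell2_relabel R _ _ (fun b => Some (b * g)%g)) => b c d [<-] [].
by move/mulIg.
Qed.

Definition rho g (u : ell2 R Gamma) : ell2 R Gamma := Ell2 (rho_subproof u g).

Lemma rho_commutant g : commutant (range (@lambda R Gamma)) (rho g).
Proof.
split=> [|_ [h _ <-]].
  split; first by move=> a u v; apply: ell2P.
  exists 1 => u; rewrite mul1r.
  apply: (@relabel_norm_le _ _ _ (fun b => Some (b * g)%g)) => // b c d [<-] [].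
  by move/mulIg.
by apply/funext => u; apply: ell2P => b /=; rewrite mulgA.
Qed.

Variable n : nat.
Local Notation H := (ell2 R ('I_n * Gamma)%type).

Lemma rhon_subproof (u : H) g :
  (fun p : 'I_n * Gamma => u (p.1, p.2 * g)%g) \in @ell2_pred R _.
Proof.
apply: (@ell2_relabel R _ _ (fun p => Some (p.1, p.2 * g)%g)).
by move=> [i b] [j c] d [<-] [-> /mulIg ->].
Qed.

Definition rhon g (u : H) : H := Ell2 (rhon_subproof u g).

Lemma rhonE g (u : H) p : rhon g u p = u (p.1, p.2 * g)%g.
Proof. by []. Qed.

Lemma rhon_linear g : linear (rhon g).
Proof. by move=> a u v; apply: ell2P. Qed.

Lemma rhon_norm g u : ell2_norm (rhon g u) <= ell2_norm u.
Proof.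
apply: (@relabel_norm_le _ _ _ (fun p => Some (p.1, p.2 * g)%g)) => //.
by move=> [i b] [j c] d [<-] [-> /mulIg ->].
Qed.

Lemma rhon_delta g (i : 'I_n) : rhon g^-1%g (delta R (i, 1%g)) = delta R (i, g).
Proof.
apply: ell2P => -[j b] /=; congr (_ %:R); rewrite !xpair_eqE; congr (_ && _ : nat).
by rewrite divg_eq1.
Qed.

Lemma tens_rhon (a : 'M[R[i]]_n) (x : ell2 R Gamma -> ell2 R Gamma) g :
  x \o rho g = rho g \o x -> forall u, tens a x (rhon g u) = rhon g (tens a x u).
Proof.
move=> xg u; rewrite /tens (lin_sum (rhon_linear g)); apply: eq_bigr => k _.
rewrite (lin_sum (rhon_linear g)); apply: eq_bigr => l _.
rewrite (lin_scale (rhon_linear g)); congr (_ *: _).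
rewrite (_ : slice l (rhon g u) = rho g (slice l u)); last exact: ell2P.
rewrite -[x _]/((x \o rho g) (slice l u)) xg.
by apply: ell2P => -[j b] /=; case: eqP.
Qed.

(** All that the theorem retains of the von Neumann algebra: its elements are
    bounded and commute with right translations. *)
Lemma mx_tensor_Linf (y : H -> H) : mx_tensor (@Linf R Gamma) y ->
  [/\ linear y, exists2 M, 0 <= M & bounded_by M y
    & forall g u, y (rhon g u) = rhon g (y u)].
Proof.
move=> [m [a [x [xL ->]]]]; split=> [c u v||g u].
- rewrite scaler_sumr -big_split; apply: eq_bigr => k _ /=.
  by have [[lx _] _] := xL k; rewrite (tens_linear (a k) lx).
- have xB k : exists M, 0 <= M /\ bounded_by M (x k).
    have [[_ [M xM]] _] := xL k; exists `|M|; split=> // u.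
    by rewrite (le_trans (xM u)) // ler_wpM2r ?ell2_norm_ge0 // ler_norm.
  have [M Mx] := choice xB.
  exists (\sum_k \sum_i \sum_j nc (a k i j) * M k).
    apply: sumr_ge0 => k _; apply: sumr_ge0 => i _; apply: sumr_ge0 => j _.
    by rewrite mulr_ge0 ?normc_ge0 //; case: (Mx k).
  move=> u; rewrite (le_trans (ell2_norm_sum _ _ _)) // mulr_suml.
  by apply: ler_sum => k _; have [M0 xM] := Mx k; exact: tens_bounded.
- rewrite (lin_sum (rhon_linear g)); apply: eq_bigr => k _; apply: tens_rhon.
  by have [_ comm] := xL k; apply: comm; exact: rho_commutant.
Qed.

Lemma iter_rhon (y : H -> H) g : (forall u, y (rhon g u) = rhon g (y u)) ->
  forall k u, iter k y (rhon g u) = rhon g (iter k y u).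
Proof. by move=> yg; elim=> // k IH u; rewrite !iterS IH yg. Qed.

Lemma op_horner_rhon (y : H -> H) g : (forall u, y (rhon g u) = rhon g (y u)) ->
  forall p u, op_horner p y (rhon g u) = rhon g (op_horner p y u).
Proof.
move=> yg p u; rewrite /op_horner (lin_sum (rhon_linear g)).
apply: eq_bigr => k _.
by rewrite (lin_scale (rhon_linear g)) iter_rhon.
Qed.

Lemma cut_tail (v : H) (e : R) : 0 < e ->
  exists S : {fset Gamma}, ell2_norm (v - cut S v) <= e.
Proof.
move=> e0; have [|B vB] := ell2_norm_approx v (e := e ^+ 2).
  exact: exprn_gt0.
exists [fset p.2 | p in B]%fset; set S := [fset _ | _ in _]%fset.
apply: ell2_norm_le => [|C]; first exact: ltW.
have tail p : nc ((v - cut S v) p) ^+ 2 <= if p \in B then 0 else nc (v p) ^+ 2.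
  rewrite ell2D ell2N cutE; case: ifP => pS.
    by rewrite subrr Normc.normc0 expr0n; case: ifP; rewrite ?sqr_ge0.
  rewrite subr0; case: ifP => // pB; case/negP: pS.
  by apply/imfsetP; exists p.
apply: le_trans (ler_sum _ (fun p _ => tail p)) _.
have := finsum_norm v (B `|` C)%fset; rewrite (big_fsetID _ (mem B)) /=.
rewrite (_ : [fset x in _ | x \in B]%fset = B); last first.
  by apply/fsetP => p; rewrite !inE /=; case: (p \in B); rewrite ?andbF.
rewrite (_ : [fset x in _ | x \notin B]%fset = [fset x in C | x \notin B]%fset); last first.
  by apply/fsetP => p; rewrite !inE /=; case: (p \in B); rewrite ?andbF.
move=> vBC; rewrite (big_fsetID _ (mem B) C) /=.
rewrite [X in X + _]big1_seq => [|p]; last by rewrite !inE /= => /andP[_ ->].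
rewrite add0r (eq_big_seq (fun p => nc (v p) ^+ 2)) => [|p]; last first.
  by rewrite !inE /= => /andP[_ /negPf ->].
by move: vB vBC; lra.
Qed.

(** If S b is inside A, the part of the translate of v that the cut removes comes
    from values of v outside S. *)
Lemma cut_rhon_tail (A S : {fset Gamma}) (v : H) b :
    (forall g, g \in S -> (g * b)%g \in A) ->
  ell2_norm (rhon b^-1%g v - cut A (rhon b^-1%g v)) <= ell2_norm (v - cut S v).
Proof.
move=> SA; apply: le_trans (rhon_norm b^-1%g _).
apply: ell2_norm_mono => -[i c]; rewrite rhonE !ell2D !ell2N !cutE /=.
case: ifP => cA; first by rewrite subrr Normc.normc0 normc_ge0.
by case: ifP => // /SA; rewrite mulgVK cA.
Qed.

Lemma card_escape (A : {fset Gamma}) g :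
  (\sum_(b <- A) ((g * b)%g \notin A : nat) <=
  #|` ((translate g A `\` A) `|` (A `\` translate g A))%fset|)%N.
Proof.
have -> : (\sum_(b <- A) ((g * b)%g \notin A : nat) =
    #|` [fset (g * b)%g | b in [fset b in A | (g * b)%g \notin A]]%fset|)%N.
  rewrite card_imfset /=; last exact: mulgI.
  rewrite (eq_bigr (fun b => if (g * b)%g \notin A then 1 else 0)%N) => [|b _].
    by rewrite -big_mkcond big_fset_condE -card_fset_sum1.
  by case: (_ \in _).
apply: fsubset_leq_card; apply/fsubsetP => _ /imfsetP[b /= + ->].
rewrite !inE /= => /andP[bA ->] /=; apply/orP; left.
by apply/imfsetP; exists b.
Qed.

End RightTranslation.

(** * Averages over a Folner net *)

Section Average.
Variables (R : realType) (X : choiceType).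
Implicit Types (A : {fset X}) (h : X -> R).

Definition avg A h : R := (\sum_(b <- A) h b) / #|` A|%:R.

Lemma avg_le A h1 h2 : (forall b, b \in A -> h1 b <= h2 b) -> avg A h1 <= avg A h2.
Proof.
move=> h12; apply: ler_wpM2r; first by rewrite invr_ge0.
by rewrite big_seq [leRHS]big_seq; apply: ler_sum.
Qed.

Lemma avgD A h1 h2 : avg A (fun b => h1 b + h2 b) = avg A h1 + avg A h2.
Proof. by rewrite /avg big_split mulrDl. Qed.

Lemma avgZ A c h : avg A (fun b => c * h b) = c * avg A h.
Proof. by rewrite /avg -mulr_sumr mulrA. Qed.

Lemma avg_sum A (J : Type) (r : seq J) (h : J -> X -> R) :
  avg A (fun b => \sum_(k <- r) h k b) = \sum_(k <- r) avg A (h k).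
Proof. by rewrite /avg exchange_big mulr_suml. Qed.

Lemma avg_cst A c : A != fset0 -> avg A (fun=> c) = c.
Proof.
rewrite -cardfs_eq0 => A0; rewrite /avg big_const_seq count_predT iter_addr addr0.
by rewrite -[c *+ _]mulr_natr mulfK // pnatr_eq0.
Qed.

Lemma avg_dist A (h : A -> R[i]) (c : R[i]) (d : X -> R) : A != fset0 ->
    (forall a, nc (h a - c) <= d (val a)) ->
  nc ((\sum_(a : A) h a) / #|` A|%:R - c) <= avg A d.
Proof.
rewrite -cardfs_eq0 -lt0n => A0 hd.
have A0R : (#|` A|%:R : R[i]) != 0 by rewrite pnatr_eq0 -lt0n.
have -> : (\sum_(a : A) h a) / #|` A|%:R - c = (\sum_(a : A) (h a - c)) / #|` A|%:R.
  rewrite sumrB sumr_const -cardfE -[c *+ _]mulr_natr mulrBl.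
  by rewrite mulfK.
have nA : nc (#|` A|%:R^-1 : R[i]) = #|` A|%:R^-1.
  by rewrite -(rmorph_nat (real_complex R)) -fmorphV normcR ger0_norm // invr_ge0.
rewrite Normc.normcM nA; apply: ler_wpM2r; first by rewrite invr_ge0.
apply: le_trans (le_normc_sum _ _ _) _.
by rewrite (big_seq_fsetE _ A predT d) /=; apply: ler_sum.
Qed.

End Average.

Lemma net_filter_filter (I : Type) (le : I -> I -> Prop) :
  directed le -> Filter (net_filter le).
Proof.
move=> [[i0] lexx letrans ledir]; apply: filter_fromT_filter; first by exists i0.
move=> i j; have [k ik jk] := ledir i j; exists k => l kl.
by split; exact: letrans kl.
Qed.

Section Folner.
Variables (R : realType) (Gamma : groupType) (I : Type) (le : I -> I -> Prop).
Variables (F : I -> {fset Gamma}) (n : nat).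
Hypotheses (hle : directed le) (hF : folner_net R le F).
Local Notation H := (ell2 R ('I_n * Gamma)%type).

#[local] Instance net_filter_instance : Filter (net_filter le).
Proof. exact: net_filter_filter. Qed.

(** Choose S finite with the tail of v off S below e/2: the translate of v by b
    leaks more than that out of F i only if g b escapes F i for some g in S. *)
Lemma avg_cut_small (v : H) (e : R) : 0 < e ->
  \forall i \near net_filter le, avg (F i) (fun b =>
    ell2_norm (rhon b^-1%g v - cut (F i) (rhon b^-1%g v))) <= e.
Proof.
move=> e0; have e2 : 0 < e / 2 by rewrite divr_gt0.
have [S vS] := cut_tail v e2; have [Fn0 folner] := hF.
pose boundary g i : R := #|` ((translate g (F i) `\` F i)
  `|` (F i `\` translate g (F i)))%fset|%:R / #|` F i|%:R.
have : (fun i => 2 * ell2_norm v * \sum_(g <- S) boundary g i) @ net_filter le -->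
    2 * ell2_norm v * \sum_(g <- S) (0 : R).
  apply: cvgMr; apply: cvg_big => [|g _]; first exact: add_continuous.
  exact: folner.
rewrite big1 // mulr0 => /cvgrPdist_le/(_ _ e2); apply: filterS => i.
rewrite sub0r normrN => /(le_trans (ler_norm _)) small.
pose esc b : R := \sum_(g <- S) ((g * b)%g \notin F i)%:R.
have esc0 b : 0 <= esc b by apply: sumr_ge0.
apply: (@le_trans _ _ (avg (F i) (fun b => e / 2 + 2 * ell2_norm v * esc b))).
  apply: avg_le => b bF.
  have [Sb|] := boolP (all (fun g => g * b \in F i)%g S).
    have /le_trans := cut_rhon_tail v (fun g gS => allP Sb g gS); apply.
    by rewrite (le_trans vS) // lerDl !mulr_ge0 ?ell2_norm_ge0.
  move=> /allPn[g gS gb]; apply: ler_wpDl; first exact: ltW.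
  apply: (@le_trans _ _ (2 * ell2_norm v)).
    have := ell2_normB (rhon b^-1%g v) (cut (F i) (rhon b^-1%g v)).
    have := cut_norm (F i) (rhon b^-1%g v); have := rhon_norm b^-1%g v; lra.
  rewrite ler_peMr ?mulr_ge0 ?ell2_norm_ge0 // /esc (big_fsetD1 g) //= gb.
  by rewrite lerDl sumr_ge0.
rewrite avgD avg_cst // avgZ avg_sum [leRHS]splitr lerD2l.
apply: le_trans small; apply: ler_wpM2l; first by rewrite mulr_ge0 ?ell2_norm_ge0.
apply: ler_sum => g _; apply: ler_wpM2r; first by rewrite invr_ge0.
by rewrite -natr_sum ler_nat card_escape.
Qed.

Variables (y : H -> H) (M : R).
Hypotheses (ly : linear y) (M0 : 0 <= M) (yM : bounded_by M y).
Hypothesis yrho : forall g u, y (rhon g u) = rhon g (y u).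

Lemma avg_iter_small (j : 'I_n) k (e : R) : 0 < e ->
  \forall i \near net_filter le, avg (F i) (fun b =>
    ell2_norm (iter k y (delta R (j, b)) -
               iter k (y \o cut (F i)) (delta R (j, b)))) <= e.
Proof.
elim: k e => [|k IH] e e0.
  apply: filterE => i; rewrite (_ : (fun b => _) = fun=> 0).
    by rewrite /avg big1 // mul0r ltW.
  by apply/funext => b /=; rewrite subrr ell2_norm0.
have M1 : 0 < M + 1 by rewrite ltr_wpDl.
have d0 : 0 < e / (M + 1) / 2 by rewrite !divr_gt0.
have cut_small := avg_cut_small (iter k y (delta R (j, 1%g))) d0.
apply: filterS (filterI cut_small (IH _ d0)) => i [le1 le2].
apply: le_trans (avg_le (fun b _ => dist_iter_compression (F i) k _ ly M0 yM)) _.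
rewrite avgZ avgD.
have shift b : iter k y (delta R (j, b)) = rhon b^-1%g (iter k y (delta R (j, 1%g))).
  by rewrite -iter_rhon ?rhon_delta.
under eq_fun do rewrite shift.
apply: (@le_trans _ _ (M * (e / (M + 1) / 2 + e / (M + 1) / 2))).
  by apply: ler_wpM2l => //; apply: lerD => //; exact: le2.
rewrite -splitr mulrCA; apply: ler_piMr; first exact: ltW.
by rewrite ler_pdivrMr // mul1r lerDl.
Qed.

(** Right invariance moves the coefficient of p(y) at the identity to a, where
    it is compared with the truncate monomial by monomial. *)
Lemma coord_compression_dist (A : {fset Gamma}) (p : {poly R[i]}) (i j : 'I_n) (a : A) :
  nc (op_horner p (compression (A := A) y) (delta R (j, a)) (i, a) -
      op_horner p y (delta R (j, 1%g)) (i, 1%g)) <=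
  \sum_(k < size p) nc p`_k *
    ell2_norm (iter k y (delta R (j, val a)) -
               iter k (y \o cut A) (delta R (j, val a))).
Proof.
have ext_delta : extn (delta R (j, a)) = delta R (j, val a).
  apply: ell2P => -[l b]; rewrite extnE /=; case: insubP => [c _ <-|bA] /=.
    by rewrite !xpair_eqE (inj_eq val_inj).
  rewrite xpair_eqE; case: eqP => //= _; case: eqP => // ba.
  by rewrite ba (valP a) in bA.
have -> : op_horner p y (delta R (j, 1%g)) (i, 1%g) =
    op_horner p y (delta R (j, val a)) (i, val a).
  by rewrite -(rhon_delta R (val a) j) op_horner_rhon // rhonE /= mulgV.
rewrite /op_horner !ell2_sum -sumrB (le_trans (le_normc_sum _ _ _)) //.
apply: ler_sum => k _; rewrite !ell2Z -mulrBr Normc.normcM ler_wpM2l ?normc_ge0 //.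
rewrite iter_compression restrnE ext_delta normcB_sym -ell2N -ell2D.
exact: ell2_norm_coord.
Qed.

Lemma avg_poly_small (j : 'I_n) (p : {poly R[i]}) (e : R) : 0 < e ->
  \forall i \near net_filter le, avg (F i) (fun b =>
    \sum_(k < size p) nc p`_k * ell2_norm (iter k y (delta R (j, b)) -
               iter k (y \o cut (F i)) (delta R (j, b)))) <= e.
Proof.
move=> e0; pose C := \sum_(k < size p) nc p`_k.
have C0 : 0 <= C by apply: sumr_ge0 => k _; exact: normc_ge0.
have C1 : 0 < C + 1 by rewrite ltr_wpDl.
have d0 : 0 < e / (C + 1) by rewrite divr_gt0.
have small : \forall i \near net_filter le, forall k : 'I_(size p), avg (F i) (fun b =>
    ell2_norm (iter k y (delta R (j, b)) -
               iter k (y \o cut (F i)) (delta R (j, b)))) <= e / (C + 1).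
  by apply: filter_forall => k; exact: avg_iter_small.
apply: filterS small => i small; rewrite avg_sum.
apply: (@le_trans _ _ (C * (e / (C + 1)))).
  rewrite mulr_suml; apply: ler_sum => k _; rewrite avgZ ler_wpM2l ?normc_ge0 //.
rewrite mulrCA; apply: ler_piMr; first exact: ltW.
by rewrite ler_pdivrMr // mul1r lerDl.
Qed.

Hypothesis sy : selfadjoint y.

(** A polynomial q within e/7 of f on [-M, M] costs 3 e/7 for y and 3 e/7 for the
    truncate, and the average for q itself is eventually within e/7. *)
Lemma counting_measure_entry_cvg (f : R -> R[i]) (k l : 'I_n) : continuous f ->
  int_counting_measure y (F i) f k l @[i --> net_filter le] -->
  int_spectral_measure y f k l.
Proof.
move=> fc; apply/cvg_normcP => e e0; have d0 : 0 < e / 7 by rewrite divr_gt0.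
have [q qf] := weierstrass_complex M fc d0; have [Fn0 _] := hF.
apply: filterS (avg_poly_small l q d0) => i small.
have slot_delta (X : choiceType) (x : X) : slot l (delta R x) = delta R (l, x).
  apply: ell2P => -[m z] /=; rewrite xpair_eqE; by case: eqP.
have approx (X : choiceType) (T : ell2 R ('I_n * X)%type -> _) x z :
    linear T -> selfadjoint T -> bounded_by M T ->
    nc (op_horner q T (delta R x) z - funcalc f T (delta R x) z) <= 3 * (e / 7).
  move=> lT sT TM; rewrite -ell2N -ell2D (le_trans (ell2_norm_coord _ _)) //.
  rewrite (le_trans (funcalc_approx lT sT M0 TM _ fc d0 qf)) //.
  by rewrite ler_piMr ?ell2_norm_delta // mulr_ge0 // ltW.
rewrite /int_counting_measure /int_spectral_measure !mxE /tau /normalised_trace /=.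
rewrite normcB_sym slot_delta.
pose d b : R := 3 * (e / 7) + (\sum_(m < size q) nc q`_m *
  ell2_norm (iter m y (delta R (l, b)) -
             iter m (y \o cut (F i)) (delta R (l, b))) + 3 * (e / 7)).
apply: (@le_trans _ _ (avg (F i) d)).
  apply: avg_dist => // a; rewrite slot_delta -/(compression (A := F i) y).
  pose qA := op_horner q (compression (A := F i) y) (delta R (l, a)) (k, a).
  rewrite -(subrKA qA) (le_trans (le_normcD _ _)) // lerD //.
    rewrite normcB_sym; apply: approx.
    - exact: compression_linear.
    - exact: compression_selfadjoint.
    - exact: compression_bounded.
  pose q1 := op_horner q y (delta R (l, 1%g)) (k, 1%g).
  rewrite -(subrKA q1) (le_trans (le_normcD _ _)) // lerD //.
    exact: coord_compression_dist.
  exact: approx.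
rewrite /d !avgD !avg_cst //; move: small; lra.
Qed.

End Folner.

Theorem theorem2p6 (R : realType) (Gamma : groupType)
    (hGamma : amenable R Gamma)
    (I : Type) (le : I -> I -> Prop) (hle : directed le)
    (F : I -> {fset Gamma}) (hF : folner_net R le F)
    (n : nat) (y : ell2 R ('I_n * Gamma)%type -> ell2 R ('I_n * Gamma)%type)
    (hy : mx_tensor (@Linf R Gamma) y) (hsa : selfadjoint y)
    (f : R -> R[i]) (fcont : continuous f)
    (fpinfty : f x @[x --> +oo] --> (0 : R[i]))
    (fninfty : f x @[x --> -oo] --> (0 : R[i])) :
  int_counting_measure y (F i) f @[i --> net_filter le]
    --> int_spectral_measure y f.
Proof.
have [ly [M M0 yM] yrho] := mx_tensor_Linf hy.
have FF := net_filter_filter hle.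
apply/cvg_mx_entourageP => A entA.
apply: filter_forall => i; apply: filter_forall => j.
have entry := counting_measure_entry_cvg hle hF ly M0 yM yrho hsa (k := i) (l := j) fcont.
have nearA : \forall k \near net_filter le,
    A (int_spectral_measure y f i j, int_counting_measure y (F k) f i j).
  exact: (cvg_entourageP _ _).1 entry A entA.
by apply: filterS nearA => k Ak; apply: mem_set.
Qed.
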